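(* Let $q\ge1$ and let $w$ be a probability function on $SL_q$ (satisfying Constant Exchangeability). Then $w$ satisfies SPx if and only if there exist $\lambda\ge0$ and probability functions $w_1,w_2$ on $SL_q$, each satisfying ULi with SPx, such that $w=(1+\lambda)w_1-\lambda w_2$.
   Context: $L_q$ is the first-order language with unary predicates $P_1,\dots,P_q$, constants $a_1,a_2,\dots$; $SL_q$ its sentences. Atoms: $\alpha_1,\dots,\alpha_{2^q}$, the formulas $\bigwedge_{i=1}^q\pm P_i(x)$; $\gamma_q(\alpha)$ = number of negated predicates in $\alpha$. State descriptions: $\bigwedge_{i=1}^m\alpha_{h_i}(a_i)$. A probability function on $SL_q$ is $w:SL_q\to[0,1]$ with $w(\top)=1$, $w(\phi\vee\theta)=w(\phi)+w(\theta)$ if $\phi\models\neg\theta$, and $w(\exists x\phi(x))=\lim_n w(\bigvee_{i\le n}\phi(a_i))$. All probability functions are assumed to satisfy Ex (invariance under permutations of constants). Px: invariance under permutations of predicate symbols. P-spectrum of $\Theta=\bigwedge_k\alpha_{h_k}(a_k)$: for each $i\in\{0,\dots,q\}$, $M_i$ is the multiset of sizes of the classes of ''$a_k\sim a_l\iff h_k=h_l$'' on constants whose atom has exactly $i$ negations; the P-spectrum is $\langle M_0,\dots,M_q\rangle$. SPx: $w(\Theta)=w(\Phi)$ for state descriptions with the same constants and the same P-spectrum. ULi with SPx: there is a family of probability functions $w^{\mathcal L}$, one for each finite unary language $\mathcal L$, each satisfying Ex, Px and SPx, with $w^{L_q}=w$ and $w^{\mathcal L'}\restriction S\mathcal L=w^{\mathcal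 L}$ whenever $\mathcal L\subseteq\mathcal L'$. *)

(* Defs.v *)
From Stdlib Require Import Reals List Arith Bool.
Import ListNotations.
Set Implicit Arguments.

(** * Syntax of unary first-order languages.
    Predicate symbols P_1, P_2, ... are indexed by nat j (P_{j+1});
    constants a_1, a_2, ... are indexed by nat i (a_{i+1});
    variables are named by nat. *)
Inductive term : Type := Var (x : nat) | Cst (i : nat).

Inductive form : Type :=
| FTop : form
| FPred (j : nat) (t : term) : form
| FNeg (p : form) : form
| FAnd (p r : form) : form
| FOr (p r : form) : form
| FEx (x : nat) (p : form) : form.

Fixpoint preds_in (L : list nat) (p : form) : Prop :=
  match p with
  | FTop => True
  | FPred j _ => In j L
  | FNeg a => preds_in L a
  | FAnd a b | FOr a b => preds_in L a /\ preds_in L b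
  | FEx _ a => preds_in L a
  end.

Fixpoint closed_in (bnd : list nat) (p : form) : Prop :=
  match p with
  | FTop => True
  | FPred _ (Var x) => In x bnd
  | FPred _ (Cst _) => True
  | FNeg a => closed_in bnd a
  | FAnd a b | FOr a b => closed_in bnd a /\ closed_in bnd b
  | FEx x a => closed_in (x :: bnd) a
  end.

Definition sentence (L : list nat) (p : form) : Prop :=
  preds_in L p /\ closed_in nil p.

Definition Lq (q : nat) : list nat := seq 0 q.

Definition subst_t (x i : nat) (t : term) : term :=
  match t with Var y => if Nat.eqb x y then Cst i else Var y | Cst c => Cst c end.

Fixpoint subst (x i : nat) (p : form) : form :=
  match p with
  | FTop => FTop
  | FPred j t => FPred j (subst_t x i t)
  | FNeg a => FNeg (subst x i a)
  | FAnd a b => FAnd (subst x i a) (subst x i b)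
  | FOr a b => FOr (subst x i a) (subst x i b)
  | FEx y a => if Nat.eqb x y then FEx y a else FEx y (subst x i a)
  end.

Fixpoint disj_upto (x : nat) (p : form) (n : nat) : form :=
  match n with
  | O => subst x 0 p
  | S k => FOr (disj_upto x p k) (subst x (S k) p)
  end.

Definition ren_t (s : nat -> nat) (t : term) : term :=
  match t with Var y => Var y | Cst c => Cst (s c) end.

Fixpoint rename_c (s : nat -> nat) (p : form) : form :=
  match p with
  | FTop => FTop
  | FPred j t => FPred j (ren_t s t)
  | FNeg a => FNeg (rename_c s a)
  | FAnd a b => FAnd (rename_c s a) (rename_c s b)
  | FOr a b => FOr (rename_c s a) (rename_c s b)
  | FEx y a => FEx y (rename_c s a)
  end.

Fixpoint rename_p (s : nat -> nat) (p : form) : form :=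
  match p with
  | FTop => FTop
  | FPred j t => FPred (s j) t
  | FNeg a => FNeg (rename_p s a)
  | FAnd a b => FAnd (rename_p s a) (rename_p s b)
  | FOr a b => FOr (rename_p s a) (rename_p s b)
  | FEx y a => FEx y (rename_p s a)
  end.

Definition bijective_nat (s : nat -> nat) : Prop :=
  exists s', (forall n, s (s' n) = n) /\ (forall n, s' (s n) = n).

Record structure : Type := {
  dom : Type;
  pint : nat -> dom -> Prop;
  cint : nat -> dom }.

Definition eval_t (M : structure) (e : nat -> dom M) (t : term) : dom M :=
  match t with Var x => e x | Cst c => cint M c end.

Definition upd (M : structure) (e : nat -> dom M) (x : nat) (d : dom M)
  : nat -> dom M := fun y => if Nat.eqb x y then d else e y.

Fixpoint sat (M : structure) (e : nat -> dom M) (p : form) : Prop :=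
  match p with
  | FTop => True
  | FPred j t => pint M j (eval_t M e t)
  | FNeg a => ~ sat M e a
  | FAnd a b => sat M e a /\ sat M e b
  | FOr a b => sat M e a \/ sat M e b
  | FEx x a => exists d : dom M, sat M (upd M e x d) a
  end.

Definition entails (p r : form) : Prop :=
  forall (M : structure) (e : nat -> dom M), sat M e p -> sat M e r.

Definition valid (p : form) : Prop :=
  forall (M : structure) (e : nat -> dom M), sat M e p.

Definition prob_fn (L : list nat) (w : form -> R) : Prop :=
  (forall p, sentence L p -> (0 <= w p <= 1)%R) /\
  (forall p, sentence L p -> valid p -> w p = 1%R) /\
  (forall p r, sentence L p -> sentence L r -> entails p (FNeg r) ->
      w (FOr p r) = (w p + w r)%R) /\
  (forall x p, sentence L (FEx x p) ->
      Un_cv (fun n => w (disj_upto x p n)) (w (FEx x p))).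

Definition Ex (L : list nat) (w : form -> R) : Prop :=
  forall s, bijective_nat s -> forall p, sentence L p -> w (rename_c s p) = w p.

Definition Px (L : list nat) (w : form -> R) : Prop :=
  forall s, bijective_nat s -> (forall j, In j L -> In (s j) L) ->
  forall p, sentence L p -> w (rename_p s p) = w p.

(** * Atoms, state descriptions, P-spectra.
    An atom of L is given by a sign function f : nat -> bool
    (f j = true : P_j unnegated), relevant only on L. *)
Definition atom_form (L : list nat) (f : nat -> bool) (t : term) : form :=
  fold_right (fun j acc => FAnd (if f j then FPred j t else FNeg (FPred j t)) acc)
    FTop L.

Fixpoint sd_from (L : list nat) (h : nat -> nat -> bool) (k : nat) (cs : list nat)
  : form :=
  match cs with
  | nil => FTop
  | c :: cs' => FAnd (atom_form L (h k) (Cst c)) (sd_from L h (S k) cs')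
  end.

Definition state_desc (L : list nat) (cs : list nat) (h : nat -> nat -> bool) : form :=
  sd_from L h 0 cs.

Definition atom_eqb (L : list nat) (f g : nat -> bool) : bool :=
  forallb (fun j => Bool.eqb (f j) (g j)) L.

Definition gamma (L : list nat) (f : nat -> bool) : nat :=
  length (filter (fun j => negb (f j)) (nodup Nat.eq_dec L)).

Definition class_size (L : list nat) (m : nat) (h : nat -> nat -> bool) (k : nat) : nat :=
  length (filter (fun l => atom_eqb L (h l) (h k)) (seq 0 m)).

Definition is_rep (L : list nat) (h : nat -> nat -> bool) (k : nat) : bool :=
  forallb (fun l => negb (atom_eqb L (h l) (h k))) (seq 0 k).

(** multiplicity of s in the multiset M_i: number of ~-classes of size s
    whose atom has exactly i negations *)
Definition spec_mult (L : list nat) (m : nat) (h : nat -> nat -> bool) (i s : nat) : nat :=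
  length (filter (fun k => is_rep L h k && Nat.eqb (gamma L (h k)) i
                            && Nat.eqb (class_size L m h k) s) (seq 0 m)).

Definition same_P_spectrum (L : list nat) (m : nat) (h g : nat -> nat -> bool) : Prop :=
  forall i s, spec_mult L m h i s = spec_mult L m g i s.

Definition SPx (L : list nat) (w : form -> R) : Prop :=
  forall (cs : list nat) (h g : nat -> nat -> bool), NoDup cs ->
  same_P_spectrum L (length cs) h g ->
  w (state_desc L cs h) = w (state_desc L cs g).

(** ULi with SPx: a family indexed by the finite unary languages
    (finite sets of predicate symbols, given as lists) *)
Definition ULi_SPx (q : nat) (w : form -> R) : Prop :=
  exists W : list nat -> form -> R,
    (forall L, prob_fn L (W L) /\ Ex L (W L) /\ Px L (W L) /\ SPx L (W L)) /\
    (forall p, sentence (Lq q) p -> W (Lq q) p = w p) /\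
    (forall L L' p, incl L L' -> sentence L p -> W L' p = W L p).

(* Main.v *)
(** Let [A] be the set of atoms of [L_q] and call the number of negations in an atom its
    level. A map [f] from [A] to the atoms of a language [L] turns a probability function
    [w] on [L_q] into one on [L], by reading [P_j(x)] as "the image under [f] of the atom
    of [x] contains [P_j]"; this is a syntactic translation, so no measure has to be
    extended.

    Choosing [f] at random, with each bit of each [f a] an independent coin of bias
    [tau a], and precomposing with a fixed [rho : A -> A], gives a family that is
    consistent over all [L] and satisfies SPx, because the law of [f a] only depends on
    levels. Conversely a function [w] with SPx is invariant under level-preserving
    permutations of [A], hence is the average of its translates by these. The sum over
    injective level-preserving maps is, by merging one atom at a time, a signed
    combination of sums [f o rho] over all level-preserving [f]; and the indicator of
    level preservation is a signed combination of coin laws, since the Bernstein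
    polynomials of degree [q] are linearly independent. Grouping the coefficients by sign
    gives the theorem. *)
Require Import Defs.
From Stdlib Require Import Reals List.
From Stdlib Require Import Lra Lia Classical Arith.

(** * Probability functions are determined by state descriptions *)

Lemma sat_ext (M : structure) (p : form) (e e' : nat -> dom M) :
  (forall y, e y = e' y) -> sat M e p <-> sat M e' p.
Proof.
  revert e e'; induction p as [|j t|p IH|p IHp r IHr|p IHp r IHr|x p IH];
    intros e e' He; simpl.
  - tauto.
  - destruct t as [x|c]; simpl; [rewrite He|]; tauto.
  - rewrite (IH _ _ He); tauto.
  - rewrite (IHp _ _ He), (IHr _ _ He); tauto.
  - rewrite (IHp _ _ He), (IHr _ _ He); tauto.
  - split; intros [d Hd]; exists d; revert Hd; apply IH; intros y; unfold upd;
      destruct (Nat.eqb x y); auto.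
Qed.

Lemma sat_subst (M : structure) (p : form) (e : nat -> dom M) (x i : nat) :
  sat M e (subst x i p) <-> sat M (upd M e x (cint M i)) p.
Proof.
  revert e; induction p as [|j t|p IH|p IHp r IHr|p IHp r IHr|y p IH];
    intros e; simpl.
  - tauto.
  - destruct t as [y|c]; simpl; [|tauto].
    unfold upd; destruct (Nat.eqb x y); simpl; tauto.
  - rewrite IH; tauto.
  - rewrite IHp, IHr; tauto.
  - rewrite IHp, IHr; tauto.
  - destruct (Nat.eqb_spec x y) as [->|Hxy]; simpl.
    + split; intros [d Hd]; exists d; revert Hd; apply sat_ext; intros z; unfold upd;
        destruct (Nat.eqb y z); auto.
    + split; intros [d Hd]; exists d; revert Hd; rewrite IH; apply sat_ext; intros z;
        unfold upd; destruct (Nat.eqb_spec x z), (Nat.eqb_spec y z); congruence.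
Qed.

Lemma sat_disj_upto (M : structure) (e : nat -> dom M) (x : nat) (p : form) (n : nat) :
  sat M e (disj_upto x p n) -> sat M e (FEx x p).
Proof.
  induction n as [|n IH]; simpl.
  - intros H; apply sat_subst in H; now exists (cint M 0).
  - intros [H|H]; [exact (IH H)|apply sat_subst in H; now exists (cint M (S n))].
Qed.

Lemma closed_in_incl (p : form) (bnd bnd' : list nat) :
  incl bnd bnd' -> closed_in bnd p -> closed_in bnd' p.
Proof.
  revert bnd bnd'; induction p as [|j t|p IH|p IHp r IHr|p IHp r IHr|x p IH];
    intros bnd bnd' Hi; simpl; eauto.
  - destruct t; auto.
  - intros []; eauto.
  - intros []; eauto.
  - apply IH; intros y [->|Hy]; simpl; auto.
Qed.

(** The list [bnd'] is only bounded by [x :: bnd], which keeps the statement stable when a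
    quantifier adds its own variable to both lists. *)
Lemma closed_in_subst (p : form) (bnd bnd' : list nat) (x i : nat) :
  incl bnd' (x :: bnd) -> closed_in bnd' p -> closed_in bnd (subst x i p).
Proof.
  revert bnd bnd'; induction p as [|j t|p IH|p IHp r IHr|p IHp r IHr|y p IH];
    intros bnd bnd' Hi; simpl; eauto.
  - destruct t as [y|c]; simpl; auto.
    intros Hy; destruct (Nat.eqb_spec x y) as [|Hxy]; auto.
    destruct (Hi _ Hy); [contradiction|auto].
  - intros []; eauto.
  - intros []; eauto.
  - destruct (Nat.eqb_spec x y) as [->|Hxy]; simpl.
    + apply closed_in_incl; intros z [->|Hz]; simpl; auto. apply Hi; auto.
    + apply IH; intros z [->|Hz]; simpl; auto. destruct (Hi _ Hz); simpl; auto.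
Qed.

Lemma preds_in_subst (L : list nat) (p : form) (x i : nat) :
  preds_in L p -> preds_in L (subst x i p).
Proof.
  induction p as [|j t|p IH|p IHp r IHr|p IHp r IHr|y p IH]; simpl; try tauto.
  destruct (Nat.eqb x y); auto.
Qed.

Lemma sentence_subst (L : list nat) (p : form) (x i : nat) :
  sentence L (FEx x p) -> sentence L (subst x i p).
Proof.
  intros [Hp Hc]; split.
  - now apply preds_in_subst.
  - apply closed_in_subst with (x :: nil); auto. apply incl_refl.
Qed.

Lemma sentence_disj_upto (L : list nat) (p : form) (x n : nat) :
  sentence L (FEx x p) -> sentence L (disj_upto x p n).
Proof.
  intros Hs; induction n as [|n IH]; [now apply sentence_subst|].
  pose proof (sentence_subst L p x (S n) Hs) as H.
  unfold sentence in *; simpl in *; tauto.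
Qed.

Ltac sent := unfold sentence in *; simpl in *; tauto.

(** * Elementary probability calculus *)

Section ProbabilityFunctions.
Variables (L : list nat) (w : form -> R).
Hypothesis Hw : prob_fn L w.
Local Open Scope R_scope.

Lemma prob_bounds (p : form) : sentence L p -> 0 <= w p <= 1.
Proof. apply Hw. Qed.

Lemma prob_or (p r : form) : sentence L p -> sentence L r -> entails p (FNeg r) ->
  w (FOr p r) = w p + w r.
Proof. apply Hw. Qed.

Lemma prob_neg (p : form) : sentence L p -> w (FNeg p) = 1 - w p.
Proof.
  intros Hp.
  assert (H : w (FOr p (FNeg p)) = 1).
  { apply Hw; [sent|]. intros M e; simpl; apply classic. }
  rewrite prob_or in H; [lra|sent|sent|]. intros M e; simpl; tauto.
Qed.

(** One entailment makes [p] and [FNeg r] disjoint, the other makes their disjunction valid, so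
    their values add up to 1. *)
Lemma prob_equiv (p r : form) : sentence L p -> sentence L r ->
  entails p r -> entails r p -> w p = w r.
Proof.
  intros Hp Hr Hpr Hrp.
  assert (H : w (FOr p (FNeg r)) = 1).
  { apply Hw; [sent|]. intros M e; simpl. destruct (classic (sat M e r)); auto. }
  rewrite prob_or in H; [|sent|sent|].
  - rewrite prob_neg in H by auto; lra.
  - intros M e H1 H2; simpl in H2; apply H2, Hpr, H1.
Qed.

Lemma prob_split (p r : form) : sentence L p -> sentence L r ->
  w p = w (FAnd p r) + w (FAnd p (FNeg r)).
Proof.
  intros Hp Hr. rewrite <- prob_or; [|sent|sent|intros M e; simpl; tauto].
  apply prob_equiv; [sent|sent| |]; intros M e; simpl; tauto.
Qed.

Lemma prob_mono (p r : form) : sentence L p -> sentence L r ->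
  entails p r -> w p <= w r.
Proof.
  intros Hp Hr H. rewrite (prob_split r p Hr Hp).
  rewrite (prob_equiv (FAnd r p) p); [|sent|sent|intros M e; simpl; tauto|].
  - assert (0 <= w (FAnd r (FNeg p)) <= 1) by (apply prob_bounds; sent). lra.
  - intros M e He; split; [now apply H|exact He].
Qed.

Lemma prob_subadd (p r : form) : sentence L p -> sentence L r ->
  w (FOr p r) <= w p + w r.
Proof.
  intros Hp Hr. rewrite (prob_split (FOr p r) p); [|sent|sent].
  apply Rplus_le_compat; (apply prob_mono; [sent|sent|]); intros M e; simpl; tauto.
Qed.

Lemma prob_unsat (p : form) : sentence L p -> entails p (FNeg FTop) -> w p = 0.
Proof.
  intros Hp H. assert (Hn : w (FNeg p) = 1).
  { apply Hw; [sent|]. intros M e Hs. apply (H M e Hs); simpl; auto. }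
  rewrite prob_neg in Hn by auto; lra.
Qed.

End ProbabilityFunctions.

Definition sym_diff (p r : form) : form := FOr (FAnd p (FNeg r)) (FAnd r (FNeg p)).

Lemma prob_sym_diff (L : list nat) (w : form -> R) (p r : form) :
  prob_fn L w -> sentence L p -> sentence L r ->
  (w p <= w r + w (sym_diff p r) /\ w r <= w p + w (sym_diff p r))%R.
Proof.
  intros Hw Hp Hr; unfold sym_diff; split.
  - eapply Rle_trans; [|apply (prob_subadd L w Hw); sent].
    apply (prob_mono L w Hw); [sent|sent|]. intros M e; simpl.
    destruct (classic (sat M e r)); tauto.
  - eapply Rle_trans; [|apply (prob_subadd L w Hw); sent].
    apply (prob_mono L w Hw); [sent|sent|]. intros M e; simpl.
    destruct (classic (sat M e p)); tauto.
Qed.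

(** * State descriptions and quantifier-free sentences *)

Lemma sat_atom_form (M : structure) (e : nat -> dom M) (L : list nat) (f : nat -> bool)
    (t : term) :
  sat M e (atom_form L f t) <->
  (forall j, In j L -> (f j = true <-> pint M j (eval_t M e t))).
Proof.
  induction L as [|i L IH]; simpl.
  - split; auto; intros _ j [].
  - rewrite IH; split.
    + intros [H1 H2] j [<-|Hj]; [|auto]. destruct (f i); simpl in H1; [tauto|].
      split; [discriminate|tauto].
    + intros H; split; [|auto]. specialize (H i (or_introl eq_refl)).
      destruct (f i); simpl; [tauto|]. intros Hp. apply H in Hp. discriminate.
Qed.

Lemma sat_sd_from (M : structure) (e : nat -> dom M) (L : list nat)
    (h : nat -> nat -> bool) (cs : list nat) (k : nat) :
  sat M e (sd_from L h k cs) <->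
  (forall i, i < length cs -> sat M e (atom_form L (h (k + i)) (Cst (nth i cs 0)))).
Proof.
  revert k; induction cs as [|c cs IH]; intros k; simpl.
  - split; auto; intros _ i Hi; lia.
  - rewrite IH; split.
    + intros [H1 H2] [|i] Hi.
      * now rewrite Nat.add_0_r.
      * replace (k + S i) with (S k + i) by lia. apply H2; lia.
    + intros H; split.
      * specialize (H 0); rewrite Nat.add_0_r in H. apply H; lia.
      * intros i Hi. specialize (H (S i)). replace (k + S i) with (S k + i) in H by lia.
        apply H; lia.
Qed.

Lemma preds_in_atom_form (L K : list nat) (f : nat -> bool) (t : term) :
  incl K L -> preds_in L (atom_form K f t).
Proof.
  intros HK; induction K as [|j K IH]; simpl; auto.
  apply incl_cons_inv in HK; destruct (f j); simpl; tauto.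
Qed.

Lemma closed_in_atom_form (bnd L : list nat) (f : nat -> bool) (t : term) :
  match t with Var x => In x bnd | Cst _ => True end -> closed_in bnd (atom_form L f t).
Proof.
  intros Ht; induction L as [|j L IH]; simpl; auto.
  split; auto. destruct (f j), t; simpl; auto.
Qed.

Lemma atom_form_sentence (L K : list nat) (f : nat -> bool) (c : nat) :
  incl K L -> sentence L (atom_form K f (Cst c)).
Proof.
  split; [now apply preds_in_atom_form|now apply closed_in_atom_form].
Qed.

Lemma state_desc_sentence (L cs : list nat) (h : nat -> nat -> bool) :
  sentence L (state_desc L cs h).
Proof.
  unfold state_desc; generalize 0; induction cs as [|c cs IH]; intros k; [sent|].
  specialize (IH (S k)); pose proof (atom_form_sentence L L (h k) c (incl_refl L)).
  sent.
Qed.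

Fixpoint qf (p : form) : Prop :=
  match p with
  | FTop | FPred _ _ => True
  | FNeg a => qf a
  | FAnd a b | FOr a b => qf a /\ qf b
  | FEx _ _ => False
  end.

Fixpoint consts (p : form) : list nat :=
  match p with
  | FTop | FPred _ (Var _) => nil
  | FPred _ (Cst c) => c :: nil
  | FNeg a | FEx _ a => consts a
  | FAnd a b | FOr a b => consts a ++ consts b
  end.

(** In both structures the constants of [cs] realize the atoms prescribed by [h], so atomic
    sentences about them have the same truth value; the connectives follow by induction. *)
Lemma state_desc_decides (L cs : list nat) (h : nat -> nat -> bool) (p : form)
    (M M' : structure) (e : nat -> dom M) (e' : nat -> dom M') :
  sat M e (state_desc L cs h) -> sat M' e' (state_desc L cs h) ->
  qf p -> sentence L p -> incl (consts p) cs -> sat M e p <-> sat M' e' p.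
Proof.
  intros HM HM'. induction p as [|j t|p IH|p IHp r IHr|p IHp r IHr|x p IH];
    simpl; intros Hq Hs Hc.
  - tauto.
  - destruct t as [x|c]; [destruct Hs as [_ []]|].
    destruct (In_nth cs c 0 (Hc c (or_introl eq_refl))) as [i [Hi Hn]].
    destruct Hs as [Hj _]; simpl in Hj.
    unfold state_desc in *; rewrite sat_sd_from in HM, HM'.
    specialize (HM i Hi); specialize (HM' i Hi); rewrite Hn in HM, HM'.
    rewrite sat_atom_form in HM, HM'. specialize (HM j Hj); specialize (HM' j Hj).
    simpl in *; tauto.
  - assert (sentence L p) by sent. rewrite IH; tauto.
  - assert (sentence L p /\ sentence L r) by sent.
    apply incl_app_inv in Hc; rewrite IHp, IHr; tauto.
  - assert (sentence L p /\ sentence L r) by sent.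
    apply incl_app_inv in Hc; rewrite IHp, IHr; tauto.
  - contradiction.
Qed.

Fixpoint fsize (p : form) : nat :=
  match p with
  | FTop | FPred _ _ => 0
  | FNeg a | FEx _ a => S (fsize a)
  | FAnd a b | FOr a b => S (fsize a + fsize b)
  end.

Lemma fsize_subst (x i : nat) (p : form) : fsize (subst x i p) = fsize p.
Proof.
  induction p as [|j t|p IH|p IHp r IHr|p IHp r IHr|y p IH]; simpl; try congruence.
  destruct (Nat.eqb x y); simpl; congruence.
Qed.

(** * Uniqueness from values on state descriptions *)

Section Uniqueness.
Variables (L : list nat) (u v : form -> R).
Hypotheses (HL : NoDup L) (Hu : prob_fn L u) (Hv : prob_fn L v).

(** Additivity splits [r] along the predicates of [K] one at a time, until only its conjunctions
    with the atoms of [c] remain. *)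
Lemma agree_atoms (c : nat) (K : list nat) (r : form) :
  NoDup K -> incl K L -> sentence L r ->
  (forall f, u (FAnd r (atom_form K f (Cst c))) = v (FAnd r (atom_form K f (Cst c)))) ->
  u r = v r.
Proof.
  revert r; induction K as [|j K IH]; intros r HK HKL Hr H.
  - specialize (H (fun _ => true)); simpl in H.
    rewrite (prob_equiv L u Hu (FAnd r FTop) r) in H by
      (try sent; intros M e; simpl; tauto).
    rewrite (prob_equiv L v Hv (FAnd r FTop) r) in H by
      (try sent; intros M e; simpl; tauto).
    exact H.
  - inversion_clear HK as [|? ? Hj HK'].
    assert (HKL' : incl K L) by (intros i Hi; apply HKL; simpl; auto).
    assert (HjL : In j L) by (apply HKL; simpl; auto).
    assert (Hs : sentence L (FPred j (Cst c))) by sent.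
    rewrite (prob_split L u Hu r _ Hr Hs), (prob_split L v Hv r _ Hr Hs).
    assert (Hcase : forall (b : bool) (r' : form),
      r' = FAnd r (if b then FPred j (Cst c) else FNeg (FPred j (Cst c))) -> u r' = v r').
    { intros b r' ->. apply IH; auto.
      - destruct b; sent.
      (* The sign at [j] is overridden by [b]; since [j] is not in [K], the atom over [K] stays the
         same. *)
      - intros f. specialize (H (fun i => if Nat.eqb i j then b else f i)).
        simpl in H. rewrite Nat.eqb_refl in H.
        replace (atom_form K (fun i => if Nat.eqb i j then b else f i) (Cst c))
          with (atom_form K f (Cst c)) in H.
        + assert (HA := atom_form_sentence L K f c HKL').
          rewrite (prob_equiv L u Hu _
            (FAnd r (FAnd (if b then FPred j (Cst c) else FNeg (FPred j (Cst c)))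
                          (atom_form K f (Cst c)))));
            [|destruct b; sent|destruct b; sent
             |intros M e; simpl; tauto|intros M e; simpl; tauto].
          rewrite H. apply (prob_equiv L v Hv);
            [destruct b; sent|destruct b; sent
             |intros M e; simpl; tauto|intros M e; simpl; tauto].
        + clear - Hj. induction K as [|i K IH]; simpl; auto.
          rewrite IH by (intros ?; apply Hj; simpl; auto).
          destruct (Nat.eqb_spec i j) as [->|]; [|reflexivity].
          exfalso; apply Hj; simpl; auto. }
    rewrite (Hcase true _ eq_refl), (Hcase false _ eq_refl). reflexivity.
Qed.

Hypothesis Hsd : forall cs h, NoDup cs -> u (state_desc L cs h) = v (state_desc L cs h).

(** The list [ds] holds the constants still to be described. Each is absorbed into [cs] by splitting
    along its atoms; once none is left, the state description either entails [p] or is inconsistent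
    with it. *)
Lemma agree_qf_and_state_desc (p : form) (ds cs : list nat) (h : nat -> nat -> bool) :
  qf p -> sentence L p -> incl (consts p) (ds ++ cs) -> NoDup cs ->
  u (FAnd p (state_desc L cs h)) = v (FAnd p (state_desc L cs h)).
Proof.
  intros Hq Hs; revert cs h; induction ds as [|d ds IH]; intros cs h Hc Hcs.
  - assert (Hsent := state_desc_sentence L cs h).
    destruct (classic (exists (M : structure) (e : nat -> dom M),
       sat M e (state_desc L cs h) /\ sat M e p)) as [[M [e [H1 H2]]]|Hn].
    + assert (Ht : forall w, prob_fn L w ->
        w (FAnd p (state_desc L cs h)) = w (state_desc L cs h)).
      { intros w Hw; apply (prob_equiv L w Hw); [sent|sent|intros M' e'; simpl; tauto|].
        intros M' e' H'; simpl; split; auto.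
        revert H2. apply state_desc_decides with (1 := H1) (2 := H'); auto. }
      rewrite !Ht; auto.
    + assert (Ht : forall w, prob_fn L w -> w (FAnd p (state_desc L cs h)) = 0%R).
      { intros w Hw; apply (prob_unsat L w Hw); [sent|].
        intros M e [H1 H2]; exfalso; apply Hn; eauto. }
      rewrite !Ht; auto.
  - destruct (in_dec Nat.eq_dec d cs) as [Hd|Hd].
    + apply IH; auto. intros c Hc'; apply Hc in Hc'; simpl in Hc'.
      destruct Hc' as [<-|]; auto. apply in_or_app; auto.
    + assert (Hsent := state_desc_sentence L cs h).
      apply (agree_atoms d L); auto; [apply incl_refl|sent|].
      intros f. set (h' := fun k => match k with O => f | S k => h k end).
      assert (Hsent' := state_desc_sentence L (d :: cs) h').
      assert (HA := atom_form_sentence L L f d (incl_refl L)).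
      assert (Heq : forall M e, sat M e (state_desc L (d :: cs) h') <->
        sat M e (atom_form L f (Cst d)) /\ sat M e (state_desc L cs h)).
      { intros M e. unfold state_desc; simpl.
        rewrite !sat_sd_from; simpl; tauto. }
      assert (Ht : forall w, prob_fn L w ->
        w (FAnd (FAnd p (state_desc L cs h)) (atom_form L f (Cst d)))
        = w (FAnd p (state_desc L (d :: cs) h'))).
      { intros w Hw; apply (prob_equiv L w Hw); [sent|sent| |].
        - intros M e [[H1 H2] H3]; split; [exact H1|apply Heq; auto].
        - intros M e [H1 H2]; apply Heq in H2; simpl; tauto. }
      rewrite !Ht by auto. apply IH.
      * intros c Hc'; apply Hc in Hc'; simpl in Hc'. apply in_or_app.
        destruct Hc' as [<-|Hc']; simpl; auto. apply in_app_or in Hc'; tauto.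
      * constructor; auto.
Qed.

Lemma agree_qf (p : form) : qf p -> sentence L p -> u p = v p.
Proof.
  intros Hq Hs.
  pose proof (agree_qf_and_state_desc p (consts p) nil (fun _ _ => true) Hq Hs) as H.
  rewrite app_nil_r in H. specialize (H (incl_refl _) (NoDup_nil _)).
  unfold state_desc in H; simpl in H.
  rewrite (prob_equiv L u Hu p (FAnd p FTop)) by (try sent; intros M e; simpl; tauto).
  rewrite (prob_equiv L v Hv p (FAnd p FTop)) by (try sent; intros M e; simpl; tauto).
  exact H.
Qed.

(** One [r] approximates [p] for [u] and [v] at the same time, so that equality at [r] can be
    carried over to [p]. *)
Definition qf_approximable (p : form) : Prop :=
  forall eps : R, (0 < eps)%R -> exists r, qf r /\ sentence L r /\
    (u (sym_diff p r) <= eps /\ v (sym_diff p r) <= eps)%R.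

Lemma prob_le_or (w : form -> R) (p r s : form) (a b : R) : prob_fn L w ->
  sentence L p -> sentence L r -> sentence L s ->
  (forall M (e : nat -> dom M), sat M e p -> sat M e r \/ sat M e s) ->
  (w r <= a)%R -> (w s <= b)%R -> (w p <= a + b)%R.
Proof.
  intros Hw Hp Hr Hs H Ha Hb.
  apply Rle_trans with (w (FOr r s)).
  - apply (prob_mono L w Hw); [sent|sent|]. exact H.
  - eapply Rle_trans; [apply (prob_subadd L w Hw); sent|lra].
Qed.

Lemma qf_approximable_or (p r : form) : sentence L p -> sentence L r ->
  qf_approximable p -> qf_approximable r -> qf_approximable (FOr p r).
Proof.
  intros Hsp Hsr Hp Hr eps He.
  destruct (Hp (eps / 2)%R) as [p' [Hq1 [Hs1 [Ha1 Hb1]]]]; [lra|].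
  destruct (Hr (eps / 2)%R) as [r' [Hq2 [Hs2 [Ha2 Hb2]]]]; [lra|].
  exists (FOr p' r'); split; [simpl; auto|split; [sent|]].
  replace eps with (eps / 2 + eps / 2)%R by lra.
  split; apply prob_le_or with (sym_diff p p') (sym_diff r r'); auto; try sent;
    intros M e; simpl; clear; tauto.
Qed.

Lemma qf_approximable_and (p r : form) : sentence L p -> sentence L r ->
  qf_approximable p -> qf_approximable r -> qf_approximable (FAnd p r).
Proof.
  intros Hsp Hsr Hp Hr eps He.
  destruct (Hp (eps / 2)%R) as [p' [Hq1 [Hs1 [Ha1 Hb1]]]]; [lra|].
  destruct (Hr (eps / 2)%R) as [r' [Hq2 [Hs2 [Ha2 Hb2]]]]; [lra|].
  exists (FAnd p' r'); split; [simpl; auto|split; [sent|]].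
  replace eps with (eps / 2 + eps / 2)%R by lra.
  split; apply prob_le_or with (sym_diff p p') (sym_diff r r'); auto; try sent;
    intros M e; simpl; clear; tauto.
Qed.

Lemma qf_approximable_neg (p : form) : sentence L p ->
  qf_approximable p -> qf_approximable (FNeg p).
Proof.
  intros Hsp Hp eps He. destruct (Hp eps He) as [p' [Hq1 [Hs1 [Ha1 Hb1]]]].
  exists (FNeg p'); split; [simpl; auto|split; [sent|]].
  split; [apply Rle_trans with (2 := Ha1); apply (prob_mono L u Hu)
         |apply Rle_trans with (2 := Hb1); apply (prob_mono L v Hv)];
    try sent; intros M e; simpl; clear; tauto.
Qed.

Lemma qf_approximable_self (p : form) : qf p -> sentence L p -> qf_approximable p.
Proof.
  intros Hq Hs eps He. exists p; split; [auto|split; [auto|]].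
  split; [rewrite (prob_unsat L u Hu)|rewrite (prob_unsat L v Hv)];
    try sent; try lra; intros M e; simpl; tauto.
Qed.

(** The finite disjunctions entail the existential sentence, so the symmetric difference is
    one-sided and its value is exactly the gap in the limit axiom. *)
Lemma exists_disj_upto_close (w : form -> R) (x : nat) (p : form) (eps : R) :
  prob_fn L w -> sentence L (FEx x p) -> (0 < eps)%R ->
  exists N, forall n, n >= N -> (w (sym_diff (FEx x p) (disj_upto x p n)) <= eps)%R.
Proof.
  intros Hw Hs He. destruct Hw as [H1 [H2 [H3 H4]]].
  destruct (H4 x p Hs eps He) as [N HN]. exists N; intros n Hn.
  assert (Hw : prob_fn L w) by (repeat split; auto; apply H1; auto).
  assert (Hd := sentence_disj_upto L p x n Hs).
  specialize (HN n Hn). unfold Rdist in HN. apply Rabs_def2 in HN.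
  assert (E1 : w (sym_diff (FEx x p) (disj_upto x p n))
             = w (FAnd (FEx x p) (FNeg (disj_upto x p n)))).
  { apply (prob_equiv L w Hw); [sent|sent| |]; intros M e;
      pose proof (sat_disj_upto M e x p n); simpl in *; tauto. }
  assert (E2 : w (FAnd (FEx x p) (disj_upto x p n)) = w (disj_upto x p n)).
  { apply (prob_equiv L w Hw); [sent|sent| |]; intros M e;
      pose proof (sat_disj_upto M e x p n); simpl in *; tauto. }
  pose proof (prob_split L w Hw (FEx x p) (disj_upto x p n) Hs Hd). lra.
Qed.

Lemma qf_approximable_ex (x : nat) (p : form) : sentence L (FEx x p) ->
  (forall i, qf_approximable (subst x i p)) -> qf_approximable (FEx x p).
Proof.
  intros Hs Hp eps He.
  destruct (exists_disj_upto_close u x p (eps / 2) Hu Hs) as [N1 HN1]; [lra|].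
  destruct (exists_disj_upto_close v x p (eps / 2) Hv Hs) as [N2 HN2]; [lra|].
  set (n := N1 + N2). specialize (HN1 n ltac:(lia)); specialize (HN2 n ltac:(lia)).
  assert (Hd : forall k, sentence L (disj_upto x p k))
    by (intros k; now apply sentence_disj_upto).
  assert (Ha : qf_approximable (disj_upto x p n)).
  { generalize n as k; induction k as [|k IH]; [apply Hp|].
    apply qf_approximable_or; auto. now apply sentence_subst. }
  destruct (Ha (eps / 2)%R) as [r [Hq [Hr [Hb1 Hb2]]]]; [lra|].
  specialize (Hd n).
  exists r; split; [auto|split; [auto|]].
  replace eps with (eps / 2 + eps / 2)%R by lra.
  split; apply prob_le_or with (sym_diff (FEx x p) (disj_upto x p n))
                               (sym_diff (disj_upto x p n) r); auto; try sent;
    intros M e; simpl; clear; tauto.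
Qed.

(** The induction is on [fsize] because the existential case passes to the instances [subst x i p],
    which are not subformulas but have the size of [p]. *)
Lemma sentence_qf_approximable (p : form) : sentence L p -> qf_approximable p.
Proof.
  remember (fsize p) as n eqn:Hn. assert (H : fsize p <= n) by lia. clear Hn.
  revert p H; induction n as [n IH] using lt_wf_ind; intros p Hn Hs.
  destruct p as [|j t|p|p r|p r|x p]; simpl in Hn.
  - apply qf_approximable_self; simpl; auto.
  - apply qf_approximable_self; simpl; auto.
  - apply qf_approximable_neg; [sent|]. apply IH with (fsize p); [lia|lia|sent].
  - apply qf_approximable_and; [sent|sent| |];
      [apply IH with (fsize p)|apply IH with (fsize r)]; solve [lia|sent].
  - apply qf_approximable_or; [sent|sent| |];
      [apply IH with (fsize p)|apply IH with (fsize r)]; solve [lia|sent].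
  - apply qf_approximable_ex; auto. intros i.
    apply IH with (fsize p); [lia|rewrite fsize_subst; lia|].
    now apply sentence_subst.
Qed.

Theorem prob_fn_unique (p : form) : sentence L p -> u p = v p.
Proof.
  intros Hs.
  assert (Hlt : forall eps, (0 < eps)%R -> (Rabs (u p - v p) <= 2 * eps)%R).
  { intros eps He. destruct (sentence_qf_approximable p Hs eps He) as [r [Hq [Hr [Ha Hb]]]].
    pose proof (prob_sym_diff L u p r Hu Hs Hr).
    pose proof (prob_sym_diff L v p r Hv Hs Hr).
    rewrite (agree_qf r Hq Hr) in *. apply Rabs_le; lra. }
  destruct (Req_dec (u p) (v p)) as [|Hne]; auto.
  assert (0 < Rabs (u p - v p))%R by (apply Rabs_pos_lt; lra).
  (* A quarter of the supposed gap as [eps] would bound the gap by half of itself. *)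
  specialize (Hlt (Rabs (u p - v p) / 4)%R); lra.
Qed.

End Uniqueness.

From mathcomp Require all_boot all_order all_algebra perm boolp Rstruct.

Module Spreading.
Import all_boot all_order all_algebra perm boolp Rstruct.
Import Order.TTheory GRing.Theory Num.Theory.
Import Defs.
Set Implicit Arguments.
Unset Strict Implicit.
Unset Printing Implicit Defensive.
Local Open Scope ring_scope.

Local Notation atom L := {ffun seq_sub (L : seq nat) -> bool}.

(** * Translations along maps of atoms *)
Lemma InE (j : nat) (L : seq nat) : In j L <-> j \in L.
Proof.
elim: L => [|i L IH] //=; rewrite in_cons; split.
  by case=> [->|/IH ->]; rewrite ?eqxx ?orbT.
by case/orP => [/eqP ->|/IH]; [left|right].
Qed.


(** Off [L] the value [false] is a default that sentences of [L] never read. *)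
Definition signs {L : seq nat} (b : atom L) (j : nat) : bool :=
  if insub j is Some x then b x else false.

Definition restr (L : seq nat) (f : nat -> bool) : atom L := [ffun x => f (val x)].

Lemma signs_val L (b : atom L) (x : seq_sub L) : signs b (val x) = b x.
Proof. by rewrite /signs valK. Qed.

Lemma signsK L (b : atom L) : restr L (signs b) = b.
Proof. by apply/ffunP => x; rewrite ffunE signs_val. Qed.

Lemma restrP L (f g : nat -> bool) : restr L f = restr L g <-> {in L, f =1 g}.
Proof.
split=> [/ffunP E j Lj|E]; first by have := E (SeqSub Lj); rewrite !ffunE.
by apply/ffunP => x; rewrite !ffunE E ?(valP x).
Qed.

Definition type_of (L : seq nat) (M : structure) (d : dom M) : atom L :=
  [ffun x => `[< pint M (val x) d >]].
Arguments type_of : clear implicits.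

Lemma sat_atom L M e f t :
  sat M e (atom_form L f t) <-> type_of L M (eval_t M e t) = restr L f.
Proof.
rewrite sat_atom_form; split=> [H|/ffunP H j /InE Lj].
  apply/ffunP => x; rewrite !ffunE; apply/asboolP/idP.
  - by move=> p; apply/H => //; apply/InE; exact: (valP x).
  - by move=> p; apply/H => //; apply/InE; exact: (valP x).
have := H (SeqSub Lj); rewrite !ffunE /= => <-.
by split=> /asboolP.
Qed.

Lemma nth_ListE (s : seq nat) (i : nat) : List.nth i s 0%N = nth 0%N s i.
Proof. by elim: s i => [|x s IH] [|i] //=. Qed.

Lemma sat_state_desc L M e cs h :
  sat M e (state_desc L cs h) <->
  forall i, (i < size cs)%N -> type_of L M (cint M (nth 0%N cs i)) = restr L (h i).
Proof.
rewrite /state_desc sat_sd_from; split=> H i Hi.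
  by have /sat_atom := H i (elimT ssrnat.ltP Hi); rewrite /= nth_ListE.
by apply/sat_atom; rewrite /= nth_ListE H //; apply/ssrnat.ltP.
Qed.

Section Translation.
Variable K : seq nat.

Definition atoms_or (P : pred (atom K)) (t : term) : form :=
  foldr FOr (FNeg FTop) [seq atom_form K (signs b) t | b <- enum {: atom K} & P b].

Fixpoint translate (f : atom K -> nat -> bool) (p : form) : form :=
  match p with
  | FTop => FTop
  | FPred j t => atoms_or (fun b => f b j) t
  | FNeg a => FNeg (translate f a)
  | FAnd a b => FAnd (translate f a) (translate f b)
  | FOr a b => FOr (translate f a) (translate f b)
  | FEx x a => FEx x (translate f a)
  end.

Lemma sat_atoms_or M e P t :
  sat M e (atoms_or P t) <-> P (type_of K M (eval_t M e t)).
Proof.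
rewrite /atoms_or.
suff H s : sat M e (foldr FOr (FNeg FTop) [seq atom_form K (signs b) t | b <- s & P b])
    <-> type_of K M (eval_t M e t) \in [seq b <- s | P b].
  by rewrite H mem_filter mem_enum inE andbT.
elim: s => [|b s IH] /=; first by split=> //; apply.
case: (P b) => //=; rewrite in_cons; split.
  by case=> [/sat_atom ->|/IH ->]; rewrite ?signsK ?eqxx ?orbT.
by case/orP => [/eqP E|/IH]; [left; apply/sat_atom; rewrite signsK|right].
Qed.

(** The semantic counterpart of [translate]: the predicates are reinterpreted along [f] on an
    unchanged domain, so facts about entailment transfer without any manipulation of formulas. *)
Definition interp (f : atom K -> nat -> bool) (M : structure) : structure :=
  {| dom := dom M; pint := fun j d => f (type_of K M d) j; cint := cint M |}.

Lemma sat_translate f M (e : nat -> dom M) p :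
  sat M e (translate f p) <-> sat (interp f M) e p.
Proof.
elim: p e => [|j t|p IH|p IHp r IHr|p IHp r IHr|x p IH] e //=.
- by rewrite sat_atoms_or; case: t.
- by rewrite IH.
- by rewrite IHp IHr.
- by rewrite IHp IHr.
- by split=> -[d] /IH H; exists d.
Qed.

Lemma valid_translate f p : valid p -> valid (translate f p).
Proof. by move=> H M e; apply/sat_translate. Qed.

Lemma entails_translate f p r : entails p r -> entails (translate f p) (translate f r).
Proof. by move=> H M e /sat_translate ?; apply/sat_translate/H. Qed.

Lemma preds_in_atoms_or P t : preds_in K (atoms_or P t).
Proof.
rewrite /atoms_or; elim: (enum _) => [|b s IH] //=.
by case: (P b) => //=; split=> //; apply: preds_in_atom_form; apply: incl_refl.
Qed.

Lemma closed_in_atoms_or bnd P t :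
  (if t is Var x then In x bnd else True) -> closed_in bnd (atoms_or P t).
Proof.
move=> Ht; rewrite /atoms_or; elim: (enum _) => [|b s IH] //=.
by case: (P b) => //=; split=> //; apply: closed_in_atom_form.
Qed.

Lemma sentence_translate L f p : sentence L p -> sentence K (translate f p).
Proof.
case=> _ Hc; split; elim: p nil Hc => [|j t|p IH|p IHp r IHr|p IHp r IHr|x p IH] bnd //=.
- by move=> _; apply: preds_in_atoms_or.
- exact: IH.
- by case=> /IHp ? /IHr.
- by case=> /IHp ? /IHr.
- exact: IH.
- by case: t => [x|c] /= H; apply: closed_in_atoms_or.
- exact: IH.
- by case=> /IHp ? /IHr.
- by case=> /IHp ? /IHr.
- exact: IH.
Qed.

(** An abstract [G] commuting with the connectives covers both substitution of a constant and
    renaming of constants. *)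
Lemma atoms_or_map (g : term -> term) (G : form -> form) P t :
  G FTop = FTop -> (forall p, G (FNeg p) = FNeg (G p)) ->
  (forall p r, G (FAnd p r) = FAnd (G p) (G r)) ->
  (forall p r, G (FOr p r) = FOr (G p) (G r)) ->
  (forall j, G (FPred j t) = FPred j (g t)) ->
  G (atoms_or P t) = atoms_or P (g t).
Proof.
move=> GT GN GA GO GP; rewrite /atoms_or; elim: (enum _) => [|b s IH] /=.
  by rewrite GN GT.
case: (P b) => //=; rewrite GO IH; congr FOr.
have H L f : G (atom_form L f t) = atom_form L f (g t).
  by elim: L => [|j L IHL] //=; rewrite GA IHL; case: (f j); rewrite ?GN GP.
exact: H.
Qed.

Lemma translate_subst f x i p : translate f (subst x i p) = subst x i (translate f p).
Proof.
elim: p => [|j t|p IH|p IHp r IHr|p IHp r IHr|y p IH] //=; rewrite ?IH ?IHp ?IHr //.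
  by rewrite (@atoms_or_map (subst_t x i)).
by case: Nat.eqb => //=; rewrite IH.
Qed.

Lemma translate_disj_upto f x p n :
  translate f (disj_upto x p n) = disj_upto x (translate f p) n.
Proof. by elim: n => [|n IH] /=; rewrite ?IH translate_subst. Qed.

Lemma translate_rename_c f s p :
  translate f (rename_c s p) = rename_c s (translate f p).
Proof.
elim: p => [|j t|p IH|p IHp r IHr|p IHp r IHr|y p IH] //=; rewrite ?IH ?IHp ?IHr //.
by rewrite (@atoms_or_map (ren_t s)).
Qed.

Lemma eq_translate L f g p : preds_in L p ->
  (forall b, {in L, f b =1 g b}) -> translate f p = translate g p.
Proof.
move=> Hp Hfg; elim: p Hp => [|j t|p IH|p IHp r IHr|p IHp r IHr|y p IH] //=.
- by move=> /InE Lj; congr foldr; congr map; apply: eq_filter => b; apply: Hfg.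
- by move=> /IH ->.
- by case=> /IHp -> /IHr ->.
- by case=> /IHp -> /IHr ->.
- by move=> /IH ->.
Qed.

Lemma translate_rename_p f s p :
  translate f (rename_p s p) = translate (fun b j => f b (s j)) p.
Proof. by elim: p => [|j t|p IH|p IHp r IHr|p IHp r IHr|y p IH] //=; rewrite ?IH ?IHp ?IHr. Qed.

Lemma prob_fn_translate L w f :
  prob_fn K w -> prob_fn L (fun p => w (translate f p)).
Proof.
case=> H1 [H2 [H3 H4]]; split; [|split; [|split]].
- by move=> p /(sentence_translate f) /H1.
- by move=> p /(sentence_translate f) Hp /(@valid_translate f); apply: H2.
- move=> p r /(sentence_translate f) Hp /(sentence_translate f) Hr.
  by move=> /(@entails_translate f); apply: H3.
- move=> x p /(sentence_translate f) Hp.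
  by have := H4 x _ Hp; congr Un_cv; apply/funext => n; rewrite translate_disj_upto.
Qed.

Lemma Ex_translate L w f : Ex K w -> Ex L (fun p => w (translate f p)).
Proof.
move=> H s Hs p Hp; rewrite translate_rename_c H //; exact: (@sentence_translate L).
Qed.

End Translation.

(** * Finite convex mixtures *)

Section Mixtures.
Variables (I : Type) (r : seq I) (c : I -> R) (v : I -> form -> R).
Hypotheses (c_ge0 : forall i, 0 <= c i) (c_sum : \sum_(i <- r) c i = 1).

Definition mix (p : form) : R := \sum_(i <- r) c i * v i p.

Lemma Un_cv_mix (u : I -> nat -> R) (l : I -> R) :
  (forall i, Un_cv (u i) (l i)) ->
  Un_cv (fun n => \sum_(i <- r) c i * u i n) (\sum_(i <- r) c i * l i).
Proof.
have cst a : Un_cv (fun=> a) a.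
  by move=> e He; exists 0%N => n _; rewrite /Rdist Rminus_diag Rabs_R0.
move=> H; elim: r => [|i s IH].
  by have := cst 0; rewrite big_nil; congr Un_cv; apply/funext => n; rewrite big_nil.
rewrite big_cons.
have := CV_plus _ _ _ _ (CV_mult _ _ _ _ (cst (c i)) (H i)) IH.
by congr Un_cv; apply/funext => n; rewrite big_cons.
Qed.

Lemma prob_fn_mix L : (forall i, prob_fn L (v i)) -> prob_fn L mix.
Proof.
move=> H; split; [|split; [|split]].
- move=> p Hp; have B i : 0 <= v i p <= 1.
    by have [/RleP -> /RleP ->] := (H i).1 p Hp.
  split; apply/RleP.
    by apply: sumr_ge0 => i _; rewrite mulr_ge0 //; case/andP: (B i).
  rewrite R1E -c_sum; apply: ler_sum => i _; rewrite ler_piMr //; by case/andP: (B i).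
- move=> p Hp Vp; rewrite /mix R1E -c_sum; apply: eq_bigr => i _.
  by rewrite (H i).2.1 // R1E mulr1.
- move=> p p' Hp Hp' E; rewrite /mix RplusE -big_split /=; apply: eq_bigr => i _.
  by rewrite (H i).2.2.1 // -mulrDr.
- by move=> x p Hp; apply: Un_cv_mix => i; apply: (H i).2.2.2.
Qed.

Lemma Ex_mix L : (forall i, Ex L (v i)) -> Ex L mix.
Proof. by move=> H s Hs p Hp; apply: eq_bigr => i _; rewrite H. Qed.

Lemma Px_mix L : (forall i, Px L (v i)) -> Px L mix.
Proof. by move=> H s Hs HL p Hp; apply: eq_bigr => i _; rewrite H. Qed.

Lemma SPx_mix L : (forall i, SPx L (v i)) -> SPx L mix.
Proof. by move=> H cs h g Hcs Hs; apply: eq_bigr => i _; rewrite (H i cs h g). Qed.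

End Mixtures.

(** * P-spectra and level-preserving permutations of atoms *)

Definition level L (b : atom L) : nat := #|[pred x | ~~ b x]|.

Lemma NoDup_uniq (s : seq nat) : NoDup s -> uniq s.
Proof. by elim=> //= x t /InE/negP -> _. Qed.

Lemma count_seq_sub (cs : seq nat) (P : pred nat) : uniq cs ->
  count (P \o val) (enum {: seq_sub cs}) = count P cs.
Proof.
move=> Ucs; rewrite -count_map; apply/seq.permP; apply: uniq_perm => //.
  by rewrite map_inj_uniq ?enum_uniq //; apply: val_inj.
move=> x; apply/mapP/idP => [[y _ ->]|xs]; first exact: valP.
by exists (SeqSub xs); rewrite ?mem_enum.
Qed.

Lemma gamma_level L f : gamma L f = level (restr L f).
Proof.
rewrite /level cardE /enum_mem size_filter -enumT.
rewrite /gamma -[LHS]/(size (filter _ _)) size_filter.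
have -> : count (mem [pred x | ~~ restr L f x]) (enum {: seq_sub L})
        = count (preim val (fun j => ~~ f j)) (enum {: seq_sub L}).
  by apply: eq_count => x; rewrite !inE ffunE.
rewrite -count_map.
apply/seq.permP; apply: uniq_perm.
- exact/NoDup_uniq/NoDup_nodup.
- by rewrite map_inj_uniq ?enum_uniq //; apply: val_inj.
move=> x; apply/idP/mapP => [/InE/(nodup_In Nat.eq_dec)/InE Lx|[y _ ->]].
  by exists (SeqSub Lx); rewrite ?mem_enum.
exact/InE/(nodup_In Nat.eq_dec)/InE/valP.
Qed.

Lemma atom_eqbE L f g : atom_eqb L f g = (restr L f == restr L g).
Proof.
apply/idP/eqP => [|/restrP H]; rewrite /atom_eqb.
  move=> H; apply/restrP => j /InE Lj.
  by move/forallb_forall: H => /(_ j Lj) /Bool.eqb_prop.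
by apply/forallb_forall => j /InE /H ->; apply: Bool.eqb_reflx.
Qed.

Definition class_card L (h : nat -> nat -> bool) (m : nat) (a : atom L) : nat :=
  count (fun l => restr L (h l) == a) (iota 0 m).

Lemma class_sizeE L m h k : class_size L m h k = class_card h m (restr L (h k)).
Proof.
rewrite /class_size /class_card -[LHS]/(size (filter _ (iota 0 m))) size_filter.
by apply: eq_count => l; rewrite /= atom_eqbE.
Qed.

Lemma is_repE L h k :
  is_rep L h k = (restr L (h k) \notin [seq restr L (h l) | l <- iota 0 k]).
Proof.
rewrite /is_rep; apply/idP/idP => [/forallb_forall H|H].
  apply/negP => /mapP [l /InE /H]; rewrite atom_eqbE => /negP H' E.
  by apply: H'; rewrite E.
apply/forallb_forall => l /InE lk; rewrite atom_eqbE; apply: contraNN H => /eqP <-.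
exact: map_f.
Qed.

(** Each value is counted at its first occurrence, so passing from [m] to [m.+1] adds one exactly
    when [H m] is new and satisfies [P]. This converts counts of class representatives into counts
    of atoms. *)
Lemma count_first_occ (T : finType) (H : nat -> T) (P : pred T) (m : nat) :
  count (fun k => (H k \notin [seq H l | l <- iota 0 k]) && P (H k)) (iota 0 m)
  = #|[pred a | (a \in [seq H l | l <- iota 0 m]) && P a]|.
Proof.
elim: m => [|m IH]; first by apply/esym/eq_card0 => a; rewrite !inE.
have -> : iota 0 m.+1 = iota 0 m ++ [:: m] by rewrite -addn1 iotaD.
have -> : #|[pred a | (a \in [seq H l | l <- iota 0 m ++ [:: m]]) && P a]|
        = #|[pred a | ((a \in [seq H l | l <- iota 0 m]) || (a == H m)) && P a]|.
  by apply: eq_card => a; rewrite !inE map_cat mem_cat inE.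
rewrite count_cat IH /= addn0.
rewrite (cardD1 (H m)) [RHS](cardD1 (H m)) !inE eqxx orbT.
have -> : #|[predD1 [pred a | ((a \in [seq H l | l <- iota 0 m]) || (a == H m)) && P a] & H m]|
        = #|[predD1 [pred a | (a \in [seq H l | l <- iota 0 m]) && P a] & H m]|.
  by apply: eq_card => a; rewrite !inE; case: eqP; rewrite ?orbF.
by case: (_ \in _) => /=; rewrite ?addn0 // addnC.
Qed.

Lemma mem_class_card L h m (a : atom L) :
  (a \in [seq restr L (h l) | l <- iota 0 m]) = (0 < class_card h m a)%N.
Proof.
rewrite /class_card -has_count; apply/mapP/hasP => -[l lm].
  by move=> ->; exists l.
by move/eqP => <-; exists l.
Qed.

Lemma spec_multE L m h i s :
  spec_mult L m h i s =
  #|[pred a : atom L | (0 < class_card h m a)%N && ((level a == i) && (class_card h m a == s))]|.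
Proof.
rewrite /spec_mult -[LHS]/(size (filter _ (iota 0 m))) size_filter.
transitivity #|[pred a : atom L | (a \in [seq restr L (h l) | l <- iota 0 m])
                  && ((level a == i) && (class_card h m a == s))]|; last first.
  by apply: eq_card => a; rewrite !inE mem_class_card.
rewrite -(count_first_occ (fun k => restr L (h k))
  (fun a => (level a == i) && (class_card h m a == s))).
apply: eq_count => k; rewrite is_repE gamma_level class_sizeE -andbA.
by congr (_ && (_ && _)); apply/PeanoNat.Nat.eqb_spec/eqP.
Qed.

(** A permutation of positions in the enumeration of [T] is transported to [T] itself through
    [enum_rank] and [enum_val]. *)
Lemma perm_of_perm_eq (T : finType) (S : eqType) (u v : T -> S) :
  perm_eq (map u (enum T)) (map v (enum T)) ->
  exists s : {perm T}, forall a, v (s a) = u a.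
Proof.
move=> Huv; pose t := map_tuple v (enum_tuple T).
have /tuple_permP [p Hp] : perm_eq (map u (enum T)) t by [].
pose f a := enum_val (p (enum_rank a)).
have fI : injective f by move=> a b /enum_val_inj /perm_inj /enum_rank_inj.
exists (perm fI) => a; rewrite permE /f.
have /(congr1 (fun s => nth (u a) s (enum_rank a))) := Hp.
rewrite (nth_map a) -?cardE // -enum_val_nth enum_rankK => ->.
by rewrite -tnth_nth tnth_mktuple tnth_map (enum_val_nth a) (tnth_nth a).
Qed.

(* The spectrum only records nonempty classes; the number of unused atoms of a given
   level is recovered as a complement. *)
Lemma perm_eq_level_class_card L m h g : same_P_spectrum L m h g ->
  perm_eq [seq (level a, class_card h m a) | a <- enum {: atom L}]
          [seq (level a, class_card g m a) | a <- enum {: atom L}].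
Proof.
move=> Hs; pose key f (a : atom L) := (level a, class_card f m a).
pose pos f := [seq key f a | a <- enum {: atom L} & (0 < class_card f m a)%N].
have posE : perm_eq (pos h) (pos g).
  apply/allP => -[i s] _; apply/eqP.
  have cnt f : count_mem (i, s) (pos f) = spec_mult L m f i s.
    rewrite spec_multE cardE /enum_mem size_filter -enumT count_map count_filter.
    by apply: eq_count => a; rewrite /= !inE xpair_eqE andbC.
  by rewrite !cnt Hs.
apply/allP => -[i s] _; apply/eqP; rewrite [LHS]count_map [RHS]count_map.
have Hpos k : (0 < k)%N -> count (preim (key h) (pred1 (i, k))) (enum {: atom L})
                         = count (preim (key g) (pred1 (i, k))) (enum {: atom L}).
  move=> k0; have cnt f : count (preim (key f) (pred1 (i, k))) (enum {: atom L})
                        = count_mem (i, k) (pos f).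
    rewrite [RHS]count_map [RHS]count_filter; apply: eq_count => a; rewrite /= xpair_eqE.
    by case: (class_card _ _ a =P k) => [->|]; rewrite ?k0 ?andbT ?andbF.
  by rewrite !cnt; apply/seq.permP.
case: s => [|s]; last exact: Hpos.
have /seq.permP /(_ (fun x => x.1 == i)) E := posE.
have cnt f : (count (preim (key f) (pred1 (i, 0%N))) (enum {: atom L})
   + count (fun x => x.1 == i) (pos f) = count (fun a => level a == i) (enum {: atom L}))%N.
  rewrite /pos [X in (_ + X)%N]count_map [X in (_ + X)%N]count_filter -count_predUI -[RHS]addn0; congr (_ + _)%N.
    by apply: eq_count => a; rewrite /= xpair_eqE; case: (class_card f m a) => [|n] /=;
      rewrite ?andbT ?andbF ?orbF.
  rewrite -[RHS](count_pred0 (enum {: atom L})); apply: eq_count => a /=.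
  by rewrite xpair_eqE; case: (class_card f m a) => [|n] /=; rewrite ?andbT ?andbF ?andbF.
by apply: (@addIn (count (fun x => x.1 == i) (pos h))); rewrite cnt E cnt.
Qed.

Lemma same_spectrum_perm L m h g : same_P_spectrum L m h g ->
  exists s : {perm atom L}, (forall a, level (s a) = level a) /\
    (forall a, class_card g m (s a) = class_card h m a).
Proof.
move=> /perm_eq_level_class_card /perm_of_perm_eq [s Hs].
by exists s; split=> a; case: (Hs a).
Qed.

Lemma sat_state_desc_uniq L M e cs h : uniq cs ->
  sat M e (state_desc L cs h) <->
  {in cs, forall c, type_of L M (cint M c) = restr L (h (index c cs))}.
Proof.
move=> U; rewrite sat_state_desc; split=> H.
  by move=> c cs_c; rewrite -H ?index_mem // nth_index.
by move=> i Hi; rewrite H ?mem_nth // index_uniq.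
Qed.

Definition rename_str (s : nat -> nat) (M : structure) : structure :=
  {| dom := dom M; pint := pint M; cint := fun c => cint M (s c) |}.

Lemma sat_rename_c s M (e : nat -> dom M) p :
  sat M e (rename_c s p) <-> sat (rename_str s M) e p.
Proof.
elim: p e => [|j t|p IH|p IHp r IHr|p IHp r IHr|x p IH] e //=.
- by case: t.
- by rewrite IH.
- by rewrite IHp IHr.
- by rewrite IHp IHr.
- by split=> -[d] /IH H; exists d.
Qed.

Lemma sentence_rename_c L s p : sentence L p -> sentence L (rename_c s p).
Proof.
case=> Hp Hc; split.
  by elim: p Hp {Hc} => //= [p IHp r IHr [/IHp ? /IHr]|p IHp r IHr [/IHp ? /IHr]].
elim: p nil Hc {Hp} => //= [j [x|c]|p IHp r IHr bnd [/IHp ? /IHr]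
  |p IHp r IHr bnd [/IHp ? /IHr]|] //.
by move=> x p IH bnd; apply: IH.
Qed.

(** Renaming constants by [s] turns the description by [h] into one logically equivalent to the
    description by [g], with the conjuncts reordered; Ex then gives the equality. *)
Lemma state_desc_perm_constants L w cs h g (s : {perm seq_sub cs}) :
  prob_fn L w -> Ex L w -> uniq cs ->
  (forall x : seq_sub cs,
     restr L (g (index (val (s x)) cs)) = restr L (h (index (val x) cs))) ->
  w (state_desc L cs h) = w (state_desc L cs g).
Proof.
move=> Pw Ew U Hs.
(* Constants outside [cs] are fixed, which extends a permutation of [cs] to a bijection of all
   constants. *)
pose f (s : {perm seq_sub cs}) c := if insub c is Some x then val (s x) else c.
have fV (t : {perm seq_sub cs}) (x : seq_sub cs) : f t (val x) = val (t x).
  by rewrite /f valK.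
have fK (t t' : {perm seq_sub cs}) : (forall x, t (t' x) = x) -> forall n, f t (f t' n) = n.
  move=> H n; rewrite {2}/f; case: insubP => [x _ <-|]; first by rewrite fV H.
  by move=> Nn; rewrite /f insubN.
have fB : bijective_nat (f s).
  exists (f s^-1)%g; split; apply: fK => x; [exact: permKV|exact: permK].
have Sh := state_desc_sentence L cs h.
rewrite -(Ew _ fB _ Sh); apply: (prob_equiv L w Pw).
- exact: sentence_rename_c.
- exact: state_desc_sentence.
- move=> M e /sat_rename_c /(sat_state_desc_uniq _ _ _ U) H.
  apply/(sat_state_desc_uniq _ _ _ U) => c cs_c.
  have -> : c = val (s (s^-1 (SeqSub cs_c)))%g by rewrite permKV.
  by rewrite Hs -fV -H //; apply: valP.
- move=> M e /(sat_state_desc_uniq _ _ _ U) H; apply/sat_rename_c.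
  apply/(sat_state_desc_uniq _ _ _ U) => c cs_c.
  have E : c = val (SeqSub cs_c) by [].
  by rewrite [in RHS]E -Hs -fV -H // fV; apply: valP.
Qed.

Lemma map_index (cs : seq nat) : uniq cs -> [seq index c cs | c <- cs] = iota 0 (size cs).
Proof.
move=> U; apply: (@eq_from_nth _ 0%N); rewrite size_map ?size_iota // => i Hi.
by rewrite (nth_map 0%N) // nth_iota // index_uniq.
Qed.

(** Equal spectra yield a level-preserving permutation of atoms matching the class sizes. After
    applying it, both descriptions assign each atom to equally many constants, hence differ by a
    permutation of constants, which Ex absorbs. *)
Lemma SPx_of_level_perm L w : prob_fn L w -> Ex L w ->
  (forall (s : {perm atom L}) cs h, (forall a, level (s a) = level a) ->
     w (state_desc L cs h) = w (state_desc L cs (fun k => signs (s (restr L (h k)))))) ->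
  SPx L w.
Proof.
move=> Pw Ew Hinv cs h g /NoDup_uniq U /same_spectrum_perm [s [Hlev Hcard]].
rewrite (Hinv s cs h Hlev); set h' := fun k => _.
have : perm_eq [seq restr L (h' (index (val x) cs)) | x <- enum {: seq_sub cs}]
               [seq restr L (g (index (val x) cs)) | x <- enum {: seq_sub cs}].
  apply/allP => a _; apply/eqP; rewrite [LHS]count_map [RHS]count_map.
  have cnt f : count (preim (fun x : seq_sub cs => restr L (f (index (val x) cs))) (pred1 a))
                 (enum {: seq_sub cs}) = class_card f (size cs) a.
    rewrite (count_seq_sub (fun c => restr L (f (index c cs)) == a) U).
    by rewrite -(count_map (index^~ cs) (fun k => restr L (f k) == a)) map_index.
  rewrite !cnt -(permKV s a) Hcard permKV.
  apply: eq_count => k; rewrite /h' signsK.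
  by apply/eqP/eqP => [<-|->]; rewrite ?permK ?permKV.
move=> /perm_of_perm_eq [t Ht].
exact: (state_desc_perm_constants Pw Ew U Ht).
Qed.

(** An injective relabelling of atoms preserves which constants share an atom, and here also the
    levels, so the P-spectrum does not change. *)
Lemma level_perm_of_SPx L w (s : {perm atom L}) cs h : SPx L w -> NoDup cs ->
  (forall a, level (s a) = level a) ->
  w (state_desc L cs h) = w (state_desc L cs (fun k => signs (s (restr L (h k))))).
Proof.
move=> Hw U Hlev; set h' := fun k => signs _.
apply: Hw => // i t; rewrite /spec_mult.
have E k l : atom_eqb L (h' k) (h' l) = atom_eqb L (h k) (h l).
  by rewrite !atom_eqbE /h' !signsK (inj_eq perm_inj).
congr length; apply: eq_filter => k.
congr (_ && _ && _).
- by rewrite /is_rep; apply: eq_all => l; rewrite E.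
- by rewrite !gamma_level /h' signsK Hlev.
- by rewrite /class_size; congr (Nat.eqb (length _) _); apply: eq_filter => l; rewrite E.
Qed.

(** * Language-invariant families *)

(** Push-forward of a product law under pointwise composition with [r]: each fibre is a product of
    fibres of [r], so its total weight factors over [I]. *)
Lemma sum_ffun_push (I X Y : finType) (r : Y -> X) (c : I -> Y -> R) (d : I -> X -> R)
    (G : {ffun I -> X} -> R) :
  (forall i x, \sum_(y | r y == x) c i y = d i x) ->
  \sum_(M : {ffun I -> Y}) (\prod_i c i (M i)) * G [ffun i => r (M i)] =
  \sum_(M : {ffun I -> X}) (\prod_i d i (M i)) * G M.
Proof.
move=> Hcd; rewrite (partition_big (fun M : {ffun I -> Y} => [ffun i => r (M i)]) predT) //=.
apply: eq_bigr => N _; under [in RHS]eq_bigr => i _ do rewrite -Hcd.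
rewrite bigA_distr_big_dep mulr_suml; apply: eq_big => [M|M /eqP -> //].
apply/eqP/familyP => [<- i|H]; first by rewrite unfold_in /= ffunE.
by apply/ffunP => i; rewrite ffunE; apply/eqP/H.
Qed.

(** For [t] in the unit interval, the law of independent coins, one per predicate, each coming out
    unnegated with probability [t]. *)
Definition weight (L : seq nat) (t : R) (b : atom L) : R :=
  \prod_x (if b x then t else 1 - t).

(** Marginals of independent coins are again such coins: each predicate outside the image of [f] is
    unconstrained and contributes the factor [t + (1 - t) = 1]. *)
Lemma sum_weight_restrict (L L' : seq nat) (f : seq_sub L -> seq_sub L') (t : R) (b : atom L) :
  injective f ->
  \sum_(b' : atom L' | [ffun x => b' (f x)] == b) weight t b' = weight t b.
Proof.
(* [Q] pins the bit at [f x] to [b x] and leaves all others free, which presents the fibre over [b]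
   as a product family. *)
move=> fI; pose Q j y := [forall x, (f x == j) ==> (y == b x)].
transitivity (\sum_(b' in family Q) weight t b').
  apply: eq_bigl => b'; apply/eqP/familyP => [E j|H].
    by rewrite unfold_in; apply/forallP => x; apply/implyP => /eqP <-; rewrite -E ffunE.
  apply/ffunP => x; rewrite ffunE; apply/eqP.
  by have := H (f x); rewrite unfold_in => /forallP /(_ x); rewrite eqxx.
rewrite /weight -(bigA_distr_big_dep Q (fun _ (y : bool) => if y then t else 1 - t)).
rewrite (bigID (mem (codom f))) /= [X in _ * X]big1 ?mulr1.
  rewrite -big_uniq; last by rewrite map_inj_uniq ?enum_uniq.
  rewrite big_map big_enum; apply: eq_bigr => x _.
  rewrite (big_pred1 (b x)) // => y; apply/forallP/eqP => [/(_ x)|-> z].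
    by rewrite eqxx => /eqP.
  by apply/implyP => /eqP /fI ->.
move=> j Nj; rewrite big_mkcond big_bool /Q.
have H y : [forall x, (f x == j) ==> (y == b x)].
  by apply/forallP => x; apply/implyP => /eqP E; rewrite -E codom_f in Nj.
by rewrite !H /= addrCA subrr addr0.
Qed.

Lemma sum_weight L t : \sum_(b : atom L) weight t b = 1.
Proof.
rewrite /weight -(bigA_distr_bigA (fun _ (y : bool) => if y then t else 1 - t)).
by rewrite big1 // => x _; rewrite big_bool /= addrCA subrr addr0.
Qed.

Lemma weight_ge0 L t (b : atom L) : 0 <= t <= 1 -> 0 <= weight t b.
Proof.
by case/andP=> t0 t1; apply: prodr_ge0 => x _; case: (b x); rewrite ?subr_ge0.
Qed.

Lemma weight_level L t (b : atom L) :
  weight t b = t ^+ (#|{: seq_sub L}| - level b) * (1 - t) ^+ level b.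
Proof.
rewrite /weight (bigID b) /=; congr (_ * _).
  rewrite (eq_bigr (fun=> t)); last by move=> x ->.
  rewrite prodr_const; congr (_ ^+ _); rewrite /level -(cardC b) -addnBA ?subnn ?addn0 //.
by rewrite (eq_bigr (fun=> 1 - t)) ?prodr_const // => x /negbTE ->.
Qed.

(** The part of [ULi_SPx] that does not mention the extended function, so that mixtures can be
    formed in all languages at once. *)
Definition ULi_family (W : list nat -> form -> R) : Prop :=
  (forall L, prob_fn L (W L) /\ Ex L (W L) /\ Px L (W L) /\ SPx L (W L)) /\
  (forall L L' p, incl L L' -> sentence L p -> W L' p = W L p).

Lemma ULi_family_mix (I : Type) (r : seq I) (c : I -> R) (W : I -> list nat -> form -> R) :
  (forall i, 0 <= c i) -> \sum_(i <- r) c i = 1 -> (forall i, ULi_family (W i)) ->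
  ULi_family (fun L => mix r c (fun i => W i L)).
Proof.
move=> c0 c1 HW; split=> [L|L L' p LL' Hp]; last first.
  by apply: eq_bigr => i _; rewrite ((HW i).2 L L' p).
split; first by apply: prob_fn_mix => // i; case: ((HW i).1 L) => ? [? []].
split; first by apply: Ex_mix => i; case: ((HW i).1 L) => ? [? []].
split; first by apply: Px_mix => i; case: ((HW i).1 L) => ? [? []].
by apply: SPx_mix => i; case: ((HW i).1 L) => ? [? []].
Qed.

(** * Random maps of atoms with independent coins *)

Section Family.
Variables (K : seq nat) (w : form -> R).
Hypotheses (Pw : prob_fn K w) (Ew : Ex K w).
Variables (tau : atom K -> R) (rho : atom K -> atom K).
Hypothesis tau01 : forall a, 0 <= tau a <= 1.

(** The expectation over a random [M] with independent values. Precomposition with [rho] makes atoms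
    with the same image under [rho] share one random value. *)
Definition spread (L : list nat) : form -> R :=
  mix (index_enum {ffun atom K -> atom L}) (fun M => \prod_a weight (tau a) (M a))
    (fun M p => w (translate (fun a => signs (M (rho a))) p)).

Lemma spread_coef_ge0 L (M : {ffun atom K -> atom L}) : 0 <= \prod_a weight (tau a) (M a).
Proof. by apply: prodr_ge0 => a _; apply: weight_ge0. Qed.

Lemma spread_coef_sum L :
  \sum_(M : {ffun atom K -> atom L}) \prod_a weight (tau a) (M a) = 1.
Proof.
rewrite -(bigA_distr_bigA (fun a b => weight (tau a) b)).
by rewrite big1 // => a _; apply: sum_weight.
Qed.

Lemma prob_fn_spread L : prob_fn L (spread L).
Proof.
apply: prob_fn_mix; [exact: spread_coef_ge0|exact: spread_coef_sum|].
by move=> M; apply: prob_fn_translate.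
Qed.

Lemma Ex_spread L : Ex L (spread L).
Proof. by apply: Ex_mix => M; apply: Ex_translate. Qed.

(** Push-forward along restriction of atoms. With [s] a permutation of [L] it gives Px, and with [s]
    the identity it gives consistency between languages. *)
Lemma spread_restrict (L L' : seq nat) (s : nat -> nat) p : preds_in L p ->
  {in L &, injective s} -> {in L, forall j, s j \in L'} ->
  spread L' (rename_p s p) = spread L p.
Proof.
move=> Hp sI sL.
pose f (x : seq_sub L) : seq_sub L' := SeqSub (sL _ (valP x)).
have fI : injective f.
  by move=> x y /(congr1 val) /= /sI E; apply: val_inj; apply: E; apply: valP.
pose G (M : {ffun atom K -> atom L}) := w (translate (fun a => signs (M (rho a))) p).
rewrite [RHS]/spread /mix -(@sum_ffun_push _ _ _ (fun b' : atom L' => [ffun x => b' (f x)])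
  (fun a b' => weight (tau a) b') (fun a b => weight (tau a) b) G).
  apply: eq_bigr => M _; congr (_ * w _); rewrite translate_rename_p.
  apply: (eq_translate Hp) => a j Lj; rewrite ffunE.
  rewrite -[j in RHS]/(val (SeqSub Lj)) signs_val ffunE.
  by rewrite -[s j]/(val (f (SeqSub Lj))) signs_val.
by move=> a b; apply: sum_weight_restrict.
Qed.

Lemma rename_p_id p : rename_p id p = p.
Proof. by elim: p => //= [p ->|p -> r ->|p -> r ->|x p ->]. Qed.

Lemma Px_spread L : Px L (spread L).
Proof.
move=> s [s' [_ sK]] sL p [Hp _]; apply: spread_restrict => //.
- by move=> x y _ _ E; rewrite -(sK x) -(sK y) E.
- by move=> j /InE /sL /InE.
Qed.

Lemma spread_incl L L' p : incl L L' -> sentence L p -> spread L' p = spread L p.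
Proof.
move=> LL' [Hp _]; rewrite -{1}(rename_p_id p); apply: spread_restrict => //.
by move=> j /InE /LL' /InE.
Qed.

Lemma type_of_interp L f M d : type_of L (interp f M) d = restr L (f (type_of K M d)).
Proof. by apply/ffunP => x; rewrite !ffunE; apply/asboolP/idP. Qed.

(** Composing [M] with a level-preserving permutation of atoms leaves its law unchanged, since by
    [weight_level] each coin law depends on the level alone. *)
Lemma SPx_spread L : SPx L (spread L).
Proof.
apply: SPx_of_level_perm; [exact: prob_fn_spread|exact: Ex_spread|].
move=> s cs h Hs; set h' := fun k => _.
pose G (M : {ffun atom K -> atom L}) :=
  w (translate (fun a => signs (M (rho a))) (state_desc L cs h')).
rewrite [RHS]/spread /mix -(@sum_ffun_push _ _ _ s
  (fun a b' => weight (tau a) b') (fun a b => weight (tau a) b) G).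
  apply: eq_bigr => M _; congr (_ * _); apply: (prob_equiv K w Pw).
  - exact/sentence_translate/state_desc_sentence.
  - exact/sentence_translate/state_desc_sentence.
  - move=> N e /sat_translate /sat_state_desc H; apply/sat_translate/sat_state_desc => i Hi.
    have := H i Hi; rewrite !type_of_interp /h' !signsK ffunE => E.
    by congr (s _).
  - move=> N e /sat_translate /sat_state_desc H; apply/sat_translate/sat_state_desc => i Hi.
    have := H i Hi; rewrite !type_of_interp /h' !signsK ffunE => E.
    exact: perm_inj E.
move=> a b; rewrite (big_pred1 ((s^-1)%g b)); last first.
  by move=> c; apply/eqP/eqP => [<-|->]; rewrite ?permK ?permKV.
by rewrite !weight_level -[in RHS](permKV s b) Hs.
Qed.

Lemma ULi_family_spread : ULi_family spread.
Proof.
split=> [L|L L' p]; last exact: spread_incl.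
split; first exact: prob_fn_spread.
split; first exact: Ex_spread.
split; [exact: Px_spread|exact: SPx_spread].
Qed.

End Family.

(** * Level-preserving maps of atoms *)

(** By [prob_fn_unique] it is enough to compare state descriptions, where the permutation acts
    without changing the P-spectrum. *)
Lemma level_perm_invariant (K : seq nat) w (g : {ffun atom K -> atom K}) p :
  NoDup K -> prob_fn K w -> SPx K w -> injective g ->
  (forall a, level (g a) = level a) -> sentence K p ->
  w (translate (fun a => signs (g a)) p) = w p.
Proof.
move=> UK Pw Sw gI gL Hp; apply/esym.
apply: (prob_fn_unique K w (fun p => w (translate (fun a => signs (g a)) p)) UK Pw _ _ p Hp).
  exact: prob_fn_translate.
move=> cs h Ucs; pose s := perm gI.
(* The inverse appears because a constant has the atom [b] after translation exactly when its
   original atom is sent to [b] by [g]. *)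
rewrite (@level_perm_of_SPx _ _ s^-1%g _ _ Sw Ucs); last first.
  by move=> a; rewrite -gL -(permE gI) permKV.
apply: (prob_equiv K w Pw).
- exact: state_desc_sentence.
- exact/sentence_translate/state_desc_sentence.
- move=> N e /sat_state_desc H; apply/sat_translate/sat_state_desc => i Hi.
  by rewrite type_of_interp signsK /= H // signsK -(permE gI) permKV.
- move=> N e /sat_translate /sat_state_desc H; apply/sat_state_desc => i Hi.
  have := H i Hi; rewrite type_of_interp !signsK => <-.
  by rewrite -(permE gI) permK.
Qed.

(* With bias [1 / (t + 1)] the Bernstein monomials are [(t + 1)^-q * t^j], so the dual
   system is an inverse Vandermonde matrix up to scaling. *)
Lemma bernstein_dual (q : nat) : exists b : nat -> 'I_q.+1 -> R,
  forall i j, (i <= q)%N -> (j <= q)%N ->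
  \sum_t b i t * ((t.+1%:R)^-1 ^+ (q - j) * (1 - (t.+1%:R)^-1) ^+ j) = (i == j)%:R.
Proof.
pose a : 'rV[R]_q.+1 := \row_t (val t)%:R.
pose V := Vandermonde q.+1 a.
have VU : V \in unitmx.
  rewrite unitmxE unitfE det_Vandermonde; apply/prodf_neq0 => i _.
  apply/prodf_neq0 => j ij; rewrite !mxE subr_eq0 eqr_nat.
  by rewrite neq_ltn ij orbT.
exists (fun i (t : 'I_q.+1) => (t.+1%:R) ^+ q * invmx V t (inord i)) => i j Hi Hj.
have := mulmxV VU => /matrixP /(_ (inord j) (inord i)); rewrite !mxE => E.
have -> : (i == j) = (inord j == inord i :> 'I_q.+1) by rewrite -val_eqE /= !inordK // eq_sym.
rewrite -E; apply: eq_bigr => t _; rewrite !mxE inordK //.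
have t0 : (t.+1%:R : R) != 0 by rewrite pnatr_eq0.
have -> : 1 - (t.+1%:R)^-1 = t%:R * (t.+1%:R)^-1 :> R.
  by rewrite -[X in X - _](mulfV t0) -[X in _ - X]mul1r -mulrBl; congr (_ * _);
    rewrite -natr1 addrK.
have E1 : (t.+1%:R ^+ q) * ((t.+1%:R)^-1 ^+ (q - j) * (t.+1%:R)^-1 ^+ j) = 1 :> R.
  by rewrite -exprD subnK // exprVn mulfV // expf_neq0.
by rewrite exprMn [LHS](AC (2*(1*2)) ((1*(3*5))*(4*2))) /= E1 mul1r.
Qed.

(** The indicator of level preservation is a product over the atoms [a]. Each factor is expanded by
    [bernstein_dual] at [level a], with its own node [t a], and the product is distributed. *)
Lemma sum_level_preserving (K : seq nat) (q : nat) : #|{: seq_sub K}| = q ->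
  exists b : {ffun atom K -> 'I_q.+1} -> R, forall F : {ffun atom K -> atom K} -> R,
  \sum_(f : {ffun atom K -> atom K} | [forall a, level (f a) == level a]) F f =
  \sum_(t : {ffun atom K -> 'I_q.+1}) b t *
    \sum_(f : {ffun atom K -> atom K}) (\prod_a weight (t a).+1%:R^-1 (f a)) * F f.
Proof.
move=> Kq; have [b Hb] := bernstein_dual q.
have levq (a : atom K) : (level a <= q)%N by rewrite -Kq; apply: max_card.
exists (fun t => \prod_a b (level a) (t a)) => F.
under [RHS]eq_bigr => t _ do rewrite mulr_sumr.
rewrite exchange_big big_mkcond /=; apply: eq_bigr => f _.
under [RHS]eq_bigr => t _ do rewrite mulrA -big_split.
rewrite -mulr_suml -(bigA_distr_bigA (fun a t => b (level a) t * weight t.+1%:R^-1 (f a))) /=.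
under [X in X * _]eq_bigr => a _ do under eq_bigr => t _ do rewrite weight_level Kq.
under [X in X * _]eq_bigr => a _ do rewrite Hb //.
case: forallP => [H|/forallP]; first by rewrite big1 ?mul1r // => a _; rewrite eq_sym H.
rewrite negb_forall => /existsP [a Ha].
by rewrite (bigD1 a) //= eq_sym (negbTE Ha) !mul0r.
Qed.

(** * Reduction of sums over injective maps *)

Section InjectiveSums.
Variables (A : finType) (lev : A -> nat).
Implicit Types (f : {ffun A -> A}) (F : {ffun A -> A} -> R).

Definition lev_preserving f : bool := [forall a, lev (f a) == lev a].

Lemma lev_preservingP f : reflect (forall a, lev (f a) = lev a) (lev_preserving f).
Proof. exact: 'forall_eqP. Qed.

Definition merge_into (x y : A) : {ffun A -> A} := [ffun a => if a == x then y else a].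

(** If the levels of [x] and [y] differ, no level-preserving map identifies them. Otherwise
    precomposition with the merge maps onto the maps having [f x = f y], and every fibre has one
    element for each choice of [f x] in the level of [x]. *)
Lemma sum_coincide (x y : A) (S : seq A) F : x \notin S -> y \in S ->
  \sum_(f | (lev_preserving f && uniq (map f S)) && (f x == f y)) F f =
  (if lev y == lev x then (#|[pred z | lev z == lev x]|%:R)^-1 else 0) *
  \sum_(f | lev_preserving f && uniq (map f S)) F [ffun a => f (merge_into x y a)].
Proof.
move=> xS yS; have xy : (y == x) = false.
  by apply/eqP => E; rewrite -E yS in xS.
case: eqP => [Exy|Nxy]; last first.
  rewrite mul0r big_pred0 // => f; apply/negP => /andP [/andP [/lev_preservingP H _] /eqP E].
  by apply: Nxy; rewrite -H -E H.
have N0 : (#|[pred z | lev z == lev x]|%:R : R) != 0.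
  by rewrite pnatr_eq0 -lt0n; apply/card_gt0P; exists x; rewrite inE.
have eqS f g : {in S, f =1 g} -> uniq (map f S) = uniq (map g S).
  by move=> /eq_in_map ->.
have SxE a : a \in S -> (a == x) = false.
  by move=> aS; apply/eqP => E; rewrite -E aS in xS.
rewrite [X in _ * X](partition_big (fun f => [ffun a => f (merge_into x y a)])
   (fun f => (lev_preserving f && uniq (map f S)) && (f x == f y))) /=; last first.
  move=> f /andP [/lev_preservingP Hf Uf]; rewrite !ffunE eqxx xy eqxx andbT.
  apply/andP; split.
    apply/lev_preservingP => a; rewrite !ffunE; case: eqP => [->|_]; last exact: Hf.
    by rewrite Hf Exy.
  by rewrite -(eqS f) // => a aS; rewrite !ffunE SxE.
rewrite mulr_sumr; apply: eq_bigr => f /andP [/andP [/lev_preservingP Hf Uf] /eqP fxy].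
rewrite (eq_bigr (fun=> F f)); last by move=> g /andP [_ /eqP ->].
(* The fibre over [f] is parametrized by the value [z] at [x], the only value that merging
   forgets. *)
pose up z : {ffun A -> A} := [ffun a => if a == x then z else f a].
rewrite (reindex_onto up (fun g : {ffun A -> A} => g x)) /=; last first.
  move=> g /andP [_ /eqP/ffunP E]; apply/ffunP => a; rewrite ffunE.
  case: eqP => [-> //|/eqP ax]; have := E a; rewrite !ffunE (negbTE ax) => -> //.
rewrite (eq_bigl [pred z | lev z == lev x]); last first.
  move=> z; rewrite !ffunE eqxx eqxx andbT inE.
  have -> : [ffun a => up z (merge_into x y a)] = f.
    apply/ffunP => a; rewrite !ffunE; case: (a =P x) => [->|/eqP/negbTE ax].
      by rewrite xy fxy.
    by rewrite ax.
  rewrite eqxx andbT (eqS (up z) f) ?Uf ?andbT; last by move=> a aS; rewrite ffunE SxE.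
  apply/lev_preservingP/eqP => [/(_ x)|Hz a]; first by rewrite ffunE eqxx.
  by rewrite ffunE; case: eqP => [-> //|_]; apply: Hf.
by rewrite sumr_const -[F f *+ _]mulr_natl mulrA mulVf // mul1r.
Qed.

(* The indicator of [f x] avoiding [f y] for [y] in [S] is [1 - \sum_y (f x == f y)] when
   [f] is injective on [S]. *)
Lemma sum_injective (S : seq A) : uniq S ->
  exists s : seq (R * {ffun A -> A}), forall F,
  \sum_(f | lev_preserving f && uniq (map f S)) F f =
  \sum_(c <- s) c.1 * \sum_(f | lev_preserving f) F [ffun a => f (c.2 a)].
Proof.
elim: S => [_|x S IH /andP [xS /IH [s Hs]]].
  exists [:: (1, [ffun a => a])] => F; rewrite big_seq1 mul1r.
  apply: eq_big => f; first by rewrite andbT.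
  by move=> _; congr F; apply/ffunP => a; rewrite !ffunE.
pose k y : R := if lev y == lev x then (#|[pred z | lev z == lev x]|%:R)^-1 else 0.
pose step y (c : R * {ffun A -> A}) : R * {ffun A -> A} :=
  (- (k y * c.1), [ffun a => c.2 (merge_into x y a)]).
(* The terms for [S] are kept; for every [y] in [S] a copy is subtracted, with maps precomposed by
   the merge and with the factor [k y] of [sum_coincide]. *)
exists (s ++ [seq step y c | y <- S, c <- s]) => F.
rewrite big_cat /= -Hs big_allpairs_dep /=.
pose P f := lev_preserving f && uniq (map f S).
have -> : \sum_(f | lev_preserving f && ((f x \notin map f S) && uniq (map f S))) F f
   = \sum_(f | P f) F f - \sum_(f | P f) (f x \in map f S)%:R * F f.
  rewrite -sumrB [RHS](bigID (fun f : {ffun A -> A} => f x \in map f S)) /=.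
  rewrite [X in _ = X + _]big1; last by move=> f /andP [_ ->]; rewrite mul1r subrr.
  rewrite add0r; apply: eq_big => [f|f /andP [_ /andP [/negbTE -> _]]].
    by rewrite /P -andbA [_ && uniq _]andbC.
  by rewrite mul0r subr0.
congr (_ + _).
have -> : \sum_(f | P f) (f x \in map f S)%:R * F f
        = \sum_(y <- S) \sum_(f | P f && (f x == f y)) F f.
  transitivity (\sum_(f | P f) \sum_(y <- S) (f x == f y)%:R * F f).
    apply: eq_bigr => f /andP [_ Uf]; rewrite -mulr_suml; congr (_ * _).
    rewrite -(count_uniq_mem _ Uf) count_map -sum1_count natr_sum big_mkcond /=.
    by apply: eq_bigr => y _; rewrite eq_sym; case: eqP.
  rewrite exchange_big /=; apply: eq_bigr => y _.
  rewrite [RHS]big_mkcondr; apply: eq_bigr => f _.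
  by case: eqP; rewrite ?mul1r ?mul0r.
rewrite -sumrN big_seq [RHS]big_seq; apply: eq_bigr => y yS.
rewrite (sum_coincide F xS yS) -/(k y).
have -> := Hs (fun f => F [ffun a => f (merge_into x y a)]).
rewrite mulr_sumr -sumrN; apply: eq_bigr => c _; rewrite mulrA mulNr; congr (- (_ * _)).
apply: eq_bigr => f _; congr F; apply/ffunP => a; by rewrite !ffunE.
Qed.

End InjectiveSums.

(** * Signed decomposition into language-invariant functions *)

(** An index pairs a term of [sum_injective], which supplies [rho], with a choice of nodes from
    [sum_level_preserving], which supplies the biases; the coefficients multiply and are divided by
    [n]. *)
Lemma spread_decomposition (K : seq nat) w : NoDup K -> prob_fn K w -> Ex K w -> SPx K w ->
  exists (I : Type) (r : seq I) (c : I -> R) (W : I -> list nat -> form -> R),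
    (forall i, ULi_family (W i)) /\
    (forall p, sentence K p -> w p = \sum_(i <- r) c i * W i K p).
Proof.
move=> UK Pw Ew Sw.
have [s Hs] := sum_injective (@level K) (enum_uniq {: atom K}).
have [b Hb] := sum_level_preserving (erefl #|{: seq_sub K}|).
pose T f := lev_preserving (@level K) f && uniq (map f (enum {: atom K})).
(* The number of level-preserving permutations of the atoms, nonzero because the identity is one of
   them. *)
pose n : R := \sum_(f | T f) 1.
have n0 : n != 0.
  rewrite /n (bigD1 [ffun a => a]) /=.
    by rewrite gt_eqF // ltr_wpDr // sumr_ge0.
  apply/andP; split; first by apply/lev_preservingP => a; rewrite ffunE.
  by rewrite map_inj_uniq ?enum_uniq // => x y; rewrite !ffunE.
pose tau (t : {ffun atom K -> 'I_#|{: seq_sub K}|.+1}) a : R := (t a).+1%:R^-1.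
pose I : Type :=
  ((R * {ffun atom K -> atom K}) * {ffun atom K -> 'I_#|{: seq_sub K}|.+1})%type.
exists I, [seq (x, t) | x <- s, t <- index_enum _].
exists (fun i : I => n^-1 * i.1.1 * b i.2).
exists (fun i : I => spread w (tau i.2) i.1.2); split.
  move=> i; apply: ULi_family_spread => // a; rewrite /tau invr_ge0 ler0n /=.
  by rewrite invf_le1 ?ltr0n // ler1n.
move=> p Hp; pose F (f : {ffun atom K -> atom K}) := w (translate (fun a => signs (f a)) p).
have E : n * w p = \sum_(f | T f) F f.
  rewrite /n mulr_suml; apply: eq_bigr => f /andP [/lev_preservingP Hf Uf].
  rewrite mul1r /F; apply/esym/level_perm_invariant => //.
  exact/injectiveP.
rewrite -[LHS](mulKf n0) E Hs big_allpairs_dep /= mulr_sumr; apply: eq_bigr => x _.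
rewrite Hb !mulr_sumr; apply: eq_bigr => t _; rewrite !mulrA; congr (_ * _).
apply: eq_bigr => f _; congr (_ * _); congr w.
by apply: (eq_translate Hp.1) => a j _; rewrite ffunE.
Qed.

(** Evaluation at [FTop] shows that the coefficients sum to 1, so their positive and negative parts
    have totals [1 + lam] and [lam]; normalizing each part gives a convex mixture. *)
Lemma signed_split (I : Type) (r : seq I) (c : I -> R) (W : I -> list nat -> form -> R)
    (K : seq nat) (w : form -> R) :
  (forall i, ULi_family (W i)) -> prob_fn K w ->
  (forall p, sentence K p -> w p = \sum_(i <- r) c i * W i K p) ->
  exists (lam : R) (W1 W2 : list nat -> form -> R), 0 <= lam /\
    ULi_family W1 /\ ULi_family W2 /\
    (forall p, sentence K p -> w p = (1 + lam) * W1 K p - lam * W2 K p).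
Proof.
move=> HW Pw Hw.
have c1 : \sum_(i <- r) c i = 1.
  have top1 v : prob_fn K v -> v FTop = 1 by case=> _ [H _]; apply: H.
  rewrite -(top1 w Pw) Hw //; apply: eq_bigr => i _.
  by rewrite (top1 (W i K)) ?mulr1 //; case: ((HW i).1 K).
pose pos i := Num.max (c i) 0; pose neg i := Num.max (- c i) 0.
have pos0 i : 0 <= pos i by rewrite le_max lexx orbT.
have neg0 i : 0 <= neg i by rewrite le_max lexx orbT.
have cE i : c i = pos i - neg i.
  rewrite /pos /neg; case: (leP 0 (c i)) => ci.
    by rewrite max_r ?subr0 // oppr_le0.
  by rewrite max_l ?sub0r ?opprK // oppr_ge0 ltW.
pose lam := \sum_(i <- r) neg i.
have lam0 : 0 <= lam by apply: sumr_ge0.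
have lam1 : 0 < 1 + lam by apply: ltr_wpDr.
have posE : \sum_(i <- r) pos i = 1 + lam.
  by rewrite -c1 -big_split; apply: eq_bigr => i _; rewrite /= cE subrK.
pose W1 L := mix r (fun i => pos i / (1 + lam)) (fun i => W i L).
have U1 : ULi_family W1.
  apply: ULi_family_mix => // [i|]; first by rewrite divr_ge0 // ltW.
  by rewrite -mulr_suml posE mulfV // gt_eqF.
have E1 p : (1 + lam) * W1 K p = \sum_(i <- r) pos i * W i K p.
  rewrite mulr_sumr; apply: eq_bigr => i _; rewrite mulrA; congr (_ * _).
  by rewrite mulrC divfK // gt_eqF.
have Hw' p : sentence K p -> w p = (1 + lam) * W1 K p - \sum_(i <- r) neg i * W i K p.
  move=> /Hw ->; rewrite E1 -sumrB; apply: eq_bigr => i _.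
  by rewrite cE mulrBl.
(* For [lam = 0] the negative part cannot be normalized; all its coefficients vanish, and [W1] can
   stand in for the second family. *)
have [lamE|lamN] := eqVneq lam 0.
  exists lam, W1, W1; split=> //; split=> //; split=> // p /Hw' ->.
  rewrite lamE mul0r; congr (_ - _).
  suff H s : \sum_(i <- s) neg i = 0 -> \sum_(i <- s) neg i * W i K p = 0 by rewrite H.
  elim: s => [|i s IH]; rewrite ?big_nil // !big_cons => /eqP.
  rewrite paddr_eq0 ?sumr_ge0 // => /andP [/eqP -> /eqP /IH ->].
  by rewrite mul0r addr0.
pose W2 L := mix r (fun i => neg i / lam) (fun i => W i L).
have U2 : ULi_family W2.
  apply: ULi_family_mix => // [i|]; first by rewrite divr_ge0.
  by rewrite -mulr_suml mulfV.
exists lam, W1, W2; split=> //; split=> //; split=> // p /Hw' ->; congr (_ - _).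
rewrite mulr_sumr; apply: eq_bigr => i _; rewrite mulrA; congr (_ * _).
by rewrite mulrC divfK.
Qed.

Lemma SPx_decomposition (q : nat) (w : form -> R) :
  prob_fn (Lq q) w -> Ex (Lq q) w -> SPx (Lq q) w ->
  exists lam : R, Rle 0 lam /\
  exists w1 w2 : form -> R,
    prob_fn (Lq q) w1 /\ ULi_SPx q w1 /\ prob_fn (Lq q) w2 /\ ULi_SPx q w2 /\
    (forall p, sentence (Lq q) p ->
       w p = Rminus (Rmult (Rplus 1 lam) (w1 p)) (Rmult lam (w2 p))).
Proof.
move=> Pw Ew Sw.
have [I [r [c [W [HW Hw]]]]] := spread_decomposition (seq_NoDup q 0) Pw Ew Sw.
have [lam [W1 [W2 [lam0 [U1 [U2 E]]]]]] := signed_split HW Pw Hw.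
exists lam; split; first exact/RleP.
have fam V : ULi_family V -> ULi_SPx q (V (Lq q)).
  by case=> H1 H2; exists V.
exists (W1 (Lq q)), (W2 (Lq q)).
split; first by case: (U1.1 (Lq q)).
split; first exact: fam.
split; first by case: (U2.1 (Lq q)).
split; first exact: fam.
by move=> p /E.
Qed.

End Spreading.

Theorem theorem3 (q : nat) (w : form -> R) :
  (1 <= q)%nat -> prob_fn (Lq q) w -> Ex (Lq q) w ->
  (SPx (Lq q) w <->
   exists lam : R, (0 <= lam)%R /\
   exists w1 w2 : form -> R,
     prob_fn (Lq q) w1 /\ ULi_SPx q w1 /\
     prob_fn (Lq q) w2 /\ ULi_SPx q w2 /\
     (forall p, sentence (Lq q) p -> w p = ((1 + lam) * w1 p - lam * w2 p)%R)).
Proof.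
  intros _ Pw Ew; split.
  - now apply Spreading.SPx_decomposition.
  - intros [lam [_ [w1 [w2 [_ [U1 [_ [U2 E]]]]]]]].
    (* The member of the family at [Lq q] has SPx and agrees with [v] on state descriptions; SPx is
       linear, so it passes to the combination. *)
    assert (S : forall v, ULi_SPx q v -> SPx (Lq q) v).
    { intros v [W [HW [Hv _]]] cs h g Hcs Hs.
      rewrite <- !Hv by apply state_desc_sentence.
      now apply HW. }
    intros cs h g Hcs Hs.
    rewrite !E by apply state_desc_sentence.
    now rewrite (S w1 U1 cs h g Hcs Hs), (S w2 U2 cs h g Hcs Hs).
Qed.
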